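(* In the setting described in the context, let $\mu_n$ denote the law of $X_n$ for $n\ge0$. Then $$\lim_{n\to+\infty}\|\mu_n-\nu\|=0.$$ If furthermore one of the following conditions is satisfied: (i) $\sum_{k\ge0}\gamma_k=+\infty$, $\sum_{k\ge0}\gamma_k^2<\infty$ and $\lim_{k\to+\infty}\gamma_k^{-1}\ln(\gamma_{k-1}/\gamma_k)=0$; (ii) $\sum_{k\ge0}\gamma_k=+\infty$, $\sum_{k\ge0}\gamma_k^2<\infty$ and $\lim_{k\to+\infty}\gamma_k^{-1}\ln(\gamma_{k-1}/\gamma_k)=\gamma_*^{-1}<2R$ for some $\gamma_*>0$; then there exist $C>0$ and $0<\rho<1$ such that for all integers $n,p\ge0$, $$\|\mu_{n+p}-\nu\|\le C\left(\rho^p+p\sqrt{\gamma_n}\right).$$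
   Context: Let $F$ be a finite set containing an element $0$, and $F^*=F\setminus\{0\}$ with cardinality $d\ge 2$. Let $P=(P_{i,j})_{i,j\in F}$ be a stochastic matrix such that $0$ is absorbing ($P_{0,i}=0$ for all $i\in F^*$), $P_{i,0}>0$ for some $i\in F^*$, and $F^*$ is an irreducible class: $\sum_{k\ge 0}(P^k)_{i,j}>0$ for all $i,j\in F^*$. No aperiodicity is assumed. Let $\hat P=(P_{i,j})_{i,j\in F^*}$. Let $\Delta$ be the set of probability measures on $F^*$, identified with the unit simplex of $\mathbb{R}^d$. Put $\|x\|=\sum_{i\in F^*}|x(i)|$. The quasi-stationary distribution $\nu$ is the unique element of $\Delta$ such that $\nu\hat P=\lambda\nu$ for some $\lambda\in(0,1)$; one has $\lambda = 1-\sum_{i\in F^*}\nu(i)P_{i,0}$. The eigenvalues of $\hat P$, with multiplicity, are $\lambda_1=\lambda,\lambda_2,\dots,\lambda_d$, with $1>\lambda_1\ge|\lambda_2|\ge\dots\ge|\lambda_d|\ge 0$ and $\lambda_i\ne\lambda$ for $i\ge2$. Set $$R=1-(1-\lambda)\max_{i\ge2}\mathrm{Re}\left(\frac1{1-\lambda_i}\right),$$ which is positive. For $x\in\Delta$ let $K[x]$ be the Markov kernel on $F^*$ given by $K[x]_{i,j}=P_{i,j}+P_{i,0}\,x(j)$. Let $(\gamma_n)_{n\ge0}$ be a decreasing sequence in $(0,1)$ with $\sum_{n}\gamma_n=+\infty$ and $\lim_{n\to\infty}\gamma_n\ln n=0$. Let $(X_n)_{n\ge0}$ be an $F^*$-valued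 process and $(x_n)_{n\ge0}$ a $\Delta$-valued process such that, with $\mathcal F_n=\sigma(X_k: k\le n)$: $x_0$ is $\mathcal F_0$-measurable (e.g. $x_0=\delta_{X_0}$), and for all $n\ge0$, $$\mathbb P(X_{n+1}=j\mid\mathcal F_n)=K[x_n]_{i,j}\ \text{ on } \{X_n=i\},\quad i,j\in F^*,\qquad x_{n+1}=(1-\gamma_n)x_n+\gamma_n\delta_{X_{n+1}}.$$ *)

(* Defs.v *)
From HB Require Import structures.
From mathcomp Require Import all_boot all_order all_algebra.
From mathcomp Require Import complex.
From mathcomp Require Import all_classical all_reals all_analysis.

Set Implicit Arguments.
Unset Strict Implicit.
Unset Printing Implicit Defensive.

Import Order.TTheory GRing.Theory Num.Theory.
Import numFieldNormedType.Exports.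

Local Open Scope classical_set_scope.
Local Open Scope ring_scope.
Local Open Scope complex_scope.

(* The state space F is 'I_d.+1 with absorbing state ord0; F^* = F \ {0} is
   indexed by 'I_d through lift ord0. Probability measures on F^* are row
   vectors 'rV_d, so that nu *m Phat is the measure nu \hat P. *)

Section Chain.
Variables (R : realType) (d : nat).
Implicit Types (P : 'M[R]_d.+1) (x : 'rV[R]_d).

Definition stochastic P : Prop :=
  (forall i j, 0 <= P i j) /\ (forall i, \sum_j P i j = 1).

Definition absorbing0 P : Prop :=
  forall i : 'I_d, P ord0 (lift ord0 i) = 0.

Definition reaches0 P : Prop :=
  exists i : 'I_d, 0 < P (lift ord0 i) ord0.

(* The sum over k may be +oo, hence the extended reals. *)
Definition irreducible_class P : Prop :=
  forall i j : 'I_d,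
    (0 < \sum_(0 <= k <oo) ((P ^+ k) (lift ord0 i) (lift ord0 j))%:E)%E.

Definition killed P : 'M[R]_d :=
  \matrix_(i, j) P (lift ord0 i) (lift ord0 j).

Definition simplex : set 'rV[R]_d :=
  [set x | (forall i, 0 <= x ord0 i) /\ \sum_i x ord0 i = 1].

Definition norm1 x : R := \sum_i `|x ord0 i|.

Definition is_qsd P (nu : 'rV[R]_d) (lam : R) : Prop :=
  [/\ simplex nu, 0 < lam < 1 & nu *m killed P = lam *: nu].

(* The complex eigenvalues of A, listed with multiplicity by decreasing
   modulus; `|z| is a (real) element of R[i]. *)
Definition is_spectrum (A : 'M[R]_d) (s : seq R[i]) : Prop :=
  char_poly (map_mx (real_complex R) A) = \prod_(z <- s) ('X - z%:P)
  /\ sorted (fun z w : R[i] => `|w| <= `|z|) s.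

Definition Re_resolvent (z : R[i]) : R := complex.Re ((1 - z)^-1).

(* s lists lambda_2, ..., lambda_d. It is non-empty when 2 <= d, so the initial
   value of the iterated maximum is one of the values maximized. *)
Definition Rgap (lam : R) (s : seq R[i]) : R :=
  1 - (1 - lam) *
      \big[Num.max/Re_resolvent (head 0 s)]_(z <- s) Re_resolvent z.

Definition reset_kernel P x : 'M[R]_d :=
  \matrix_(i, j) (P (lift ord0 i) (lift ord0 j)
                  + P (lift ord0 i) ord0 * x ord0 j).

End Chain.

Section Steps.
Variables (R : realType) (gamma : nat -> R).

Definition admissible_steps : Prop :=
  [/\ forall n, 0 < gamma n < 1,
      {homo gamma : m n / (m <= n)%N >-> n <= m},
      (\sum_(0 <= n <oo) (gamma n)%:E = +oo)%E &
      (gamma n * ln n%:R) @[n --> \oo] --> (0 : R)].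

(* k is shifted by one, since gamma_(k-1) is only defined for k >= 1. *)
Definition log_ratio (k : nat) : R :=
  (gamma k.+1)^-1 * ln (gamma k / gamma k.+1).

Definition condition_i : Prop :=
  [/\ (\sum_(0 <= k <oo) (gamma k)%:E = +oo)%E,
      (\sum_(0 <= k <oo) (gamma k ^+ 2)%:E < +oo)%E &
      log_ratio k @[k --> \oo] --> (0 : R)].

Definition condition_ii (gap : R) : Prop :=
  [/\ (\sum_(0 <= k <oo) (gamma k)%:E = +oo)%E,
      (\sum_(0 <= k <oo) (gamma k ^+ 2)%:E < +oo)%E &
      exists gamma_star : R,
        [/\ 0 < gamma_star,
            log_ratio k @[k --> \oo] --> gamma_star^-1 &
            gamma_star^-1 < 2 * gap]].

End Steps.

Section Process.
Variables (R : realType) (d : nat).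
Variables (disp : measure_display) (Omega : measurableType disp).
Variable (Pr : probability Omega R).
Implicit Types (X : nat -> Omega -> 'I_d) (x : nat -> Omega -> 'rV[R]_d).

Definition history X (n : nat) : set (set Omega) :=
  <<s [set A | exists k i, (k <= n)%N /\ A = X k @^-1` [set i]] >>.

Definition measurable_wrt (G : set (set Omega)) (f : Omega -> R) : Prop :=
  forall B : set R, measurable B -> G (f @^-1` B).

(* f is a version of the conditional probability Pr(A | G). *)
Definition is_cond_prob (G : set (set Omega)) (A : set Omega)
    (f : Omega -> R) : Prop :=
  measurable_wrt G f /\
  forall B, G B -> Pr (A `&` B) = (\int[Pr]_(w in B) (f w)%:E)%E.

(* The events {X_n = i} partition Omega, so prescribing the conditional
   probability to be K[x_n]_{i,j} on each of them is prescribing it to be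
   K[x_n]_{X_n,j}. *)
Definition is_algorithm (P : 'M[R]_d.+1) (gamma : nat -> R) X x : Prop :=
  [/\ forall n i, measurable (X n @^-1` [set i]),
      forall n w, simplex (x n w),
      forall j, measurable_wrt (history X 0) (fun w => x 0%N w ord0 j),
      forall n j, is_cond_prob (history X n) (X n.+1 @^-1` [set j])
        (fun w => reset_kernel P (x n w) (X n w) j) &
      forall n w, x n.+1 w =
        (1 - gamma n) *: x n w + gamma n *: delta_mx ord0 (X n.+1 w)].

Definition law X (n : nat) : 'rV[R]_d :=
  \row_i fine (Pr (X n @^-1` [set i])).

End Process.

(* Main.v *)
Require Import Defs.
From HB Require Import structures.
From mathcomp Require Import all_boot all_order all_algebra.
From mathcomp Require Import complex.
From mathcomp Require Import all_classical all_reals all_analysis.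
From mathcomp Require Import spectral ring lra.

Set Implicit Arguments.
Unset Strict Implicit.
Unset Printing Implicit Defensive.

Import Order.TTheory GRing.Theory Num.Theory.
Import numFieldNormedType.Exports.

Local Open Scope classical_set_scope.
Local Open Scope ring_scope.
Local Open Scope complex_scope.

(** For x in the simplex, K[x] has invariant law stat x = xA / (xA1), where
    A = (1 - Phat)^-1, and its Poisson equation has the explicit solution
    A - A1 (stat x).  The mean-field flow x' = stat x - x is linear in the
    projective coordinate x / (xu), u the right Perron vector, up to the time
    change 1 / (xA1): a quadratic form V in this coordinate, adapted to the
    spectrum of A deflated at its Perron eigenvalue (Schur form), decays at a
    rate close to 2 Rgap near nu, and V + (V / delta)^m V does so on the whole
    simplex.  Corrected by the Poisson solution, the latter satisfies
      E Phi_(n+1) <= (1 - rate gamma_n) E Phi_n + C gamma_n ^ 2,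
    so that E |x_n - nu|^2 tends to 0, and is O(gamma_n) under (i) or (ii).
    Finally mu_(n+1) - nu = (mu_n - nu) K[nu] + O(E |x_n - nu|), and K[nu]
    contracts zero-sum vectors geometrically, since nu > 0
    makes it aperiodic. *)

(** * Perron-Frobenius theory for irreducible non-negative matrices *)

Section Perron.
Context {R : realType} {n : nat}.
Implicit Types (M : 'M[R]_n) (w : 'rV[R]_n) (v : 'cV[R]_n).

(** The kernel is affine in x, so running K[x_n] instead of K[nu] costs at most E |x_n - nu| per
    step. Over p steps this gives p such terms, and a mean square of order gamma_n makes each of
    order sqrt(gamma_n); no almost sure statement about x_n is required. The threshold 2 Rgap arises
    as follows: at nu the clock 1 / (xA1) has speed 1 - lam, the linear flow contracts at rate 1 /
    (1 - lam) minus the real part of 1 / (1 - lam_i), the product of the two is at least Rgap, and a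
    quadratic form doubles it. Every rate below 2 Rgap is reached, so the strict inequality of
    condition (ii) leaves room for a rate above the limit it bounds. The noise is Markovian, not
    centred: given X_n, the mean of delta_(X_(n+1)) - x_n is not stat x_n - x_n. The Poisson
    correction absorbs the difference. It carries a factor gamma_n and is made non-negative, so that
    monotone steps alone control its change from one time to the next. On the measure side, x_n
    takes finitely many values, and everything goes through a positive linear functional on
    functions of (x_n, X_n). *)

Definition nonneg_mx M := forall i j, 0 <= M i j.
Definition irreducible_mx M := forall i j, exists k, 0 < (M ^+ k) i j.

Lemma nonneg_exp M k : nonneg_mx M -> nonneg_mx (M ^+ k).
Proof.
move=> hM; elim: k => [|k IH] i j; first by rewrite expr0 mxE; case: eqP.
by rewrite exprS mxE; apply: sumr_ge0 => l _; apply: mulr_ge0.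
Qed.

Lemma irreducible_tr M : irreducible_mx M -> irreducible_mx M^T.
Proof.
move=> h i j; have [k hk] := h j i; exists k.
suff -> : M^T ^+ k = (M ^+ k)^T by rewrite mxE.
elim: k {hk} => [|k IH]; first by rewrite !expr0 [LHS](esym (trmx1 _ _)).
by rewrite exprSr exprS IH [LHS](esym (trmx_mul _ _)).
Qed.

Lemma row_eigen_exp M w l k : w *m M = l *: w -> w *m M ^+ k = l ^+ k *: w.
Proof.
move=> h; elim: k => [|k IH]; first by rewrite !expr0 [LHS]mulmx1 scale1r.
by rewrite exprSr [w *m _]mulmxA IH -scalemxAl h scalerA exprSr.
Qed.

(** If [w 0 i] vanished, so would the i-th entry of [w *m M ^+ k = l ^+ k *: w]; but irreducibility
    carries mass to i from any j with [w 0 j] positive. *)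
Lemma nonneg_eigen_pos M w l : nonneg_mx M -> irreducible_mx M ->
  w *m M = l *: w -> (forall i, 0 <= w 0 i) -> w != 0 -> forall i, 0 < w 0 i.
Proof.
move=> hM irr hw w0 wn0 i.
have [j wj] : exists j, w 0 j != 0.
  apply/existsP; apply: contraNT wn0 => /existsPn h.
  by apply/eqP/rowP => j; rewrite mxE; move: (h j); rewrite negbK => /eqP.
have [k hk] := irr j i.
rewrite lt_neqAle w0 andbT eq_sym; apply/eqP => wi.
have := congr1 (fun z : 'rV_n => z 0 i) (row_eigen_exp k hw).
rewrite mxE mxE wi mulr0 => /eqP; rewrite gt_eqF //.
rewrite (bigD1 j) //= ltr_pwDl //.
  by rewrite mulr_gt0 // lt_neqAle eq_sym wj w0.
by apply: sumr_ge0 => l' _; rewrite mulr_ge0 // nonneg_exp.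
Qed.

(* Pairing with a positive left eigenvector turns the triangle inequality
   l |v| <= M |v| into an equality. *)
Lemma abs_eigen M (mu : 'rV[R]_n) v l : nonneg_mx M -> 0 <= l ->
  mu *m M = l *: mu -> (forall i, 0 < mu 0 i) -> M *m v = l *: v ->
  M *m map_mx Num.norm v = l *: map_mx Num.norm v.
Proof.
move=> hM l0 hmu mu0 hv.
pose D := M *m map_mx Num.norm v - l *: map_mx Num.norm v.
have D0 i : 0 <= D i 0.
  rewrite !mxE subr_ge0 -(ger0_norm l0) -normrM.
  have /(congr1 (fun z : 'cV_n => z i 0)) := hv; rewrite !mxE => <-.
  apply: le_trans (ler_norm_sum _ _ _) _; apply: ler_sum => j _.
  by rewrite normrM mxE (ger0_norm (hM _ _)).
have : (mu *m D) 0 0 = 0.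
  by rewrite mulmxBr mulmxA hmu -scalemxAl -scalemxAr subrr mxE.
rewrite mxE => /psumr_eq0P h.
apply/subr0_eq/colP => i; rewrite -/D [RHS]mxE.
have /eqP := h (fun i _ => mulr_ge0 (ltW (mu0 i)) (D0 i)) i isT.
by rewrite mulf_eq0 gt_eqF //= => /eqP.
Qed.

Lemma abs_col_eigen_pos M (mu : 'rV[R]_n) v l : nonneg_mx M ->
  irreducible_mx M -> 0 <= l -> mu *m M = l *: mu -> (forall i, 0 < mu 0 i) ->
  M *m v = l *: v -> v != 0 ->
  M *m map_mx Num.norm v = l *: map_mx Num.norm v /\ forall i, 0 < `|v i 0|.
Proof.
move=> hM irr l0 hmu mu0 hv v0; have h := abs_eigen hM l0 hmu mu0 hv.
split=> // i.
have := @nonneg_eigen_pos M^T (map_mx Num.norm v)^T l _ (irreducible_tr irr).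
move=> /(_ _ _ _ _ i); rewrite !mxE; apply.
- by move=> i' j'; rewrite mxE.
- by rewrite -trmx_mul h linearZ.
- by move=> j; rewrite !mxE.
- apply: contraNneq v0 => /rowP e; apply/eqP/colP => j.
  by have := e j; rewrite !mxE => /eqP; rewrite normr_eq0 => /eqP.
Qed.

(** The left eigenvector makes [M - l%:M] singular, so some right eigenvector exists; its entrywise
    absolute value is a positive one, then normalised against [mu]. *)
Lemma right_perron M (mu : 'rV[R]_n) l : nonneg_mx M -> irreducible_mx M ->
  0 <= l -> mu *m M = l *: mu -> (forall i, 0 < mu 0 i) -> (0 < n)%N ->
  exists u : 'cV[R]_n,
    [/\ M *m u = l *: u, forall i, 0 < u i 0 & mu *m u = 1%:M].
Proof.
move=> hM irr l0 hmu mu0 n0.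
have : \det (M - l%:M)^T = 0.
  rewrite det_tr; apply/eqP/det0P; exists mu.
    apply/eqP => /rowP /(_ (Ordinal n0)) e.
    by have := mu0 (Ordinal n0); rewrite e mxE ltxx.
  by rewrite mulmxBr hmu mul_mx_scalar subrr.
move=> /eqP/det0P [v v0 hv].
have hv' : M *m v^T = l *: v^T.
  have := congr1 trmx hv; rewrite trmx_mul trmxK trmx0 mulmxBl mul_scalar_mx.
  by move/subr0_eq.
have [] := abs_col_eigen_pos hM irr l0 hmu mu0 hv'.
  by apply: contraNneq v0 => e; rewrite -(trmxK v) e trmx0.
set v' := map_mx _ _ => hv'' vpos.
have s0 : 0 < (mu *m v') 0 0.
  rewrite mxE (bigD1 (Ordinal n0)) //= ltr_pwDl //.
    by rewrite mulr_gt0 // mxE.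
  by apply: sumr_ge0 => i _; rewrite mulr_ge0 ?mxE // ltW.
exists ((((mu *m v') 0 0)^-1) *: v'); split.
- by rewrite -scalemxAr hv'' !scalerA mulrC.
- by move=> i; rewrite mxE [v' i 0]mxE mulr_gt0 // invr_gt0.
- rewrite -scalemxAr [X in _ *: X]mx11_scalar scale_scalar_mx mulVf //.
  by rewrite gt_eqF.
Qed.

(** Subtracting from [w] the multiple of [mu] given by the smallest ratio leaves a non-negative
    eigenvector with a zero entry, hence 0. So [w] is a multiple of [mu], and [mu *m u] is
    positive. *)
Lemma row_eigen_simple M (mu : 'rV[R]_n) l (u : 'cV[R]_n) w :
  nonneg_mx M -> irreducible_mx M -> mu *m M = l *: mu ->
  (forall i, 0 < mu 0 i) -> (forall i, 0 < u i 0) ->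
  w *m M = l *: w -> w *m u = 0 -> w = 0.
Proof.
move=> hM irr hmu mu0 u0 hw wu.
have [n0|n0] := posnP n.
  by apply/rowP => i; have := ltn_ord i; rewrite {2}n0.
pose i0 := [arg min_(i < Ordinal n0) (w 0 i / mu 0 i)]%O.
pose c := w 0 i0 / mu 0 i0.
have hc i : c * mu 0 i <= w 0 i.
  rewrite -ler_pdivlMr // /c /i0.
  by case: arg_minP => // i1 _ /(_ i isT).
have z0 : w - c *: mu = 0.
  apply/eqP; apply: contraT => zn0.
  have := @nonneg_eigen_pos M (w - c *: mu) l hM irr _ _ zn0 i0.
  rewrite !mxE /c divfK ?gt_eqF // subrr ltxx; apply.
    by rewrite mulmxBl hw -scalemxAl hmu scalerBr !scalerA mulrC.
  by move=> i; rewrite !mxE subr_ge0.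
have e : w = c *: mu by apply: subr0_eq.
have : (c *: (mu *m u)) 0 0 = 0 by rewrite scalemxAl -e wu mxE.
rewrite mxE => /eqP; rewrite mulf_eq0 => /orP [/eqP c0|]; first by rewrite e c0 scale0r.
rewrite gt_eqF // mxE (bigD1 (Ordinal n0)) //= ltr_pwDl //.
  by rewrite mulr_gt0.
by apply: sumr_ge0 => i _; rewrite mulr_ge0 // ltW.
Qed.

End Perron.

(** * The killed matrix and the kernel with resetting *)

Section KilledChain.
Context {R : realType} {d : nat}.
Implicit Types (P : 'M[R]_d.+1) (x : 'rV[R]_d).

Definition ones : 'cV[R]_d := const_mx 1.

Lemma mulmx_ones (x : 'rV[R]_d) : (x *m ones) 0 0 = \sum_i x 0 i.
Proof. by rewrite mxE; apply: eq_bigr => i _; rewrite mxE mulr1. Qed.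

Lemma killed_ge0 P : stochastic P -> nonneg_mx (killed P).
Proof. by move=> [h _] i j; rewrite mxE. Qed.

Lemma killed_row_sum P i : stochastic P ->
  (killed P *m ones) i 0 = 1 - P (lift ord0 i) ord0.
Proof.
move=> [_ h]; rewrite -(h (lift ord0 i)) big_ord_recl addrAC subrr add0r mxE.
by apply: eq_bigr => j _; rewrite !mxE mulr1.
Qed.

(** A path between two states of F^* never visits the absorbing state, so restriction to F^*
    commutes with powers. *)
Lemma killed_exp P k : absorbing0 P ->
  killed (P ^+ k) = killed P ^+ k.
Proof.
move=> h0.
have e0 : forall k j, (P ^+ k) ord0 (lift ord0 j) = 0.
  elim=> [|m IH] j; first by rewrite expr0 mxE.
  rewrite exprS mxE big_ord_recl IH mulr0 add0r big1 // => l _.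
  by rewrite h0 mul0r.
elim: k => [|k IH]; apply/matrixP => i j.
  by rewrite !expr0 !mxE (inj_eq (@lift_inj _ ord0)).
rewrite (exprS (killed P)) -IH [LHS]mxE exprS !mxE big_ord_recl e0 mulr0 add0r.
by apply: eq_bigr => l _; rewrite !mxE.
Qed.

Lemma killed_irreducible P : stochastic P -> absorbing0 P ->
  irreducible_class P -> irreducible_mx (killed P).
Proof.
move=> sP h0 irr i j; apply: contrapT => h.
have := irr i j; rewrite eseries0 ?ltxx // => k _ _.
rewrite (_ : (P ^+ k) _ _ = (killed P ^+ k) i j); last first.
  by rewrite -killed_exp // mxE.
congr (_%:E); apply/eqP; rewrite eq_le (nonneg_exp k (killed_ge0 sP)) andbT.
by rewrite leNgt; apply/negP => ?; apply: h; exists k.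
Qed.

(** [ones - killed P *m ones] is the vector of killing probabilities: the kernel is a rank-one
    perturbation that depends on [P] only through [killed P]. *)
Lemma reset_kernelE P x : stochastic P ->
  reset_kernel P x = killed P + (ones - killed P *m ones) *m x.
Proof.
move=> sP; apply/matrixP => i j; rewrite !mxE big_ord1 !mxE; congr (_ + _ * _).
have /(_ i) := killed_row_sum _ sP; rewrite mxE => ->.
by rewrite opprB addrC subrK.
Qed.

End KilledChain.

(** * Resolvent, invariant laws and the Poisson equation *)

Section Resolvent.
Context {R : realType} {d : nat}.
Variables (M : 'M[R]_d) (lam : R) (nu : 'rV[R]_d) (u : 'cV[R]_d).
Hypothesis hM : nonneg_mx M.
Hypothesis hM1 : forall i, (M *m ones) i 0 <= 1.
Hypothesis lam1 : lam < 1.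
Hypothesis hnu : nu *m M = lam *: nu.
Hypothesis hu : M *m u = lam *: u.
Hypothesis u0 : forall i, 0 < u i 0.

Definition resolvent : 'M[R]_d := invmx (1%:M - M).
Local Notation A := resolvent.

Definition exit_time : 'cV[R]_d := A *m ones.
Local Notation a := exit_time.

(** A null row vector v satisfies |v| <= |v| M entrywise; pairing with [u] gives |v| u <= lam |v| u,
    and lam < 1 with u > 0 forces v = 0. *)
Lemma resolvent_unit : 1%:M - M \in unitmx.
Proof.
rewrite unitmxE unitfE; apply/negP => /det0P [v vn0 hv].
have hv' : v = v *m M by move: hv; rewrite mulmxBr mulmx1 => /subr0_eq.
have h j : `|v 0 j| <= (map_mx Num.norm v *m M) 0 j.
  rewrite {1}hv' !mxE; apply: le_trans (ler_norm_sum _ _ _) _.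
  by apply: ler_sum => i _; rewrite normrM mxE (ger0_norm (hM _ _)).
have s : (map_mx Num.norm v *m u) 0 0 <= lam * (map_mx Num.norm v *m u) 0 0.
  have -> : lam * (map_mx Num.norm v *m u) 0 0
          = ((map_mx Num.norm v *m M) *m u) 0 0.
    by rewrite -mulmxA hu -scalemxAr [RHS]mxE.
  rewrite mxE [leRHS]mxE; apply: ler_sum => j _.
  by rewrite ler_wpM2r ?mxE ?(ltW (u0 _)) //; have := h j; rewrite mxE.
have n0 j : 0 <= map_mx Num.norm v 0 j * u j 0.
  by rewrite mxE mulr_ge0 // ltW.
have z : (map_mx Num.norm v *m u) 0 0 = 0.
  have : 0 <= (map_mx Num.norm v *m u) 0 0.
    by rewrite mxE; apply: sumr_ge0 => j _; exact: n0.
  move: s; set t := (_ *m _) 0 0 => s t0; apply/eqP; rewrite eq_le t0 andbT.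
  by have := lam1; nra.
move: z; rewrite mxE => /psumr_eq0P z.
case/negP: vn0; apply/eqP/rowP => j; rewrite [RHS]mxE.
have /eqP := z (fun i _ => n0 i) j isT.
by rewrite mxE mulf_eq0 (gt_eqF (u0 j)) orbF normr_eq0 => /eqP.
Qed.

Lemma resolventKl : A = 1%:M + M *m A.
Proof.
have /subr0_eq // : A - (1%:M + M *m A) = 0.
have := mulmxV resolvent_unit; rewrite mulmxBl mul1mx -/A => e.
by rewrite opprD addrCA e addrC subrr.
Qed.

Lemma nu_resolvent : nu *m A = (1 - lam)^-1 *: nu.
Proof.
have l : 1 - lam != 0 by rewrite subr_eq0 gt_eqF.
have : nu *m (1%:M - M) = (1 - lam) *: nu.
  by rewrite mulmxBr mulmx1 hnu scalerBl scale1r.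
move=> /(congr1 (fun z => (1 - lam)^-1 *: (z *m A))).
rewrite -mulmxA mulmxV ?resolvent_unit // mulmx1 => ->.
by rewrite -scalemxAl scalerA mulVf // scale1r.
Qed.

Lemma resolvent_u : A *m u = (1 - lam)^-1 *: u.
Proof.
have l : 1 - lam != 0 by rewrite subr_eq0 gt_eqF.
have : (1%:M - M) *m u = (1 - lam) *: u.
  by rewrite mulmxBl mul1mx hu scalerBl scale1r.
move=> /(congr1 (fun z => (1 - lam)^-1 *: (A *m z))).
rewrite mulmxA mulVmx ?resolvent_unit // mul1mx => ->.
by rewrite -scalemxAr scalerA mulVf // scale1r.
Qed.

Lemma exit_timeE : a = ones + M *m a.
Proof. by rewrite /a {1}resolventKl mulmxDl mul1mx mulmxA. Qed.

Lemma exit_time_ge1 i : 1 <= a i 0.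
Proof.
have e j : a j 0 = 1 + \sum_k M j k * a k 0.
  by rewrite {1}exit_timeE !mxE.
suff p j : 0 <= a j 0.
  by rewrite e ler_wpDr // sumr_ge0 // => k _; rewrite mulr_ge0.
(* Minimum principle for a = 1 + M a: at a negative minimum, row sums at most 1 would give (1 - s) a
   >= 1 with the left side non-positive. *)
pose i0 := [arg min_(k < i) (a k 0)]%O.
have hmin k : a i0 0 <= a k 0 by rewrite /i0; case: arg_minP => // i1 _; apply.
apply: le_trans (hmin j); rewrite leNgt; apply/negP => neg.
have : (\sum_k M i0 k) * a i0 0 <= \sum_k M i0 k * a k 0.
  by rewrite mulr_suml; apply: ler_sum => k _; rewrite ler_wpM2l.
have s1 : \sum_k M i0 k <= 1.
  have := hM1 i0; rewrite mxE; under eq_bigr => k _ do rewrite mxE mulr1.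
  by [].
have := e i0; set s := \sum_k M i0 k * _; move=> *; nra.
Qed.

Definition mean_time (x : 'rV[R]_d) : R := (x *m a) 0 0.

Lemma mean_time_ge1 x : simplex x -> 1 <= mean_time x.
Proof.
move=> [x0 x1]; rewrite /mean_time mxE -[leLHS]x1; apply: ler_sum => i _.
by rewrite ler_peMr // exit_time_ge1.
Qed.

Definition reset (x : 'rV[R]_d) : 'M[R]_d := M + (ones - M *m ones) *m x.

(** Renewal formula: the occupation measure of one life started from [x], divided by its mean
    length. *)
Definition stat (x : 'rV[R]_d) : 'rV[R]_d := (mean_time x)^-1 *: (x *m A).

Definition poisson (x : 'rV[R]_d) : 'M[R]_d := A - a *m stat x.

(** Since [x *m poisson x = 0], the rank-one part of [reset x] drops out and only the equation for
    [M] is left, which the resolvent solves. No convergence of powers of the kernel is involved, so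
    periodicity is harmless. *)
Lemma poissonP x : simplex x ->
  reset x *m poisson x = poisson x - 1%:M + ones *m stat x.
Proof.
move=> hx; have t0 : mean_time x != 0.
  by rewrite gt_eqF // (lt_le_trans ltr01) // mean_time_ge1.
have xa : x *m a = (mean_time x)%:M by rewrite [LHS]mx11_scalar.
have xF : x *m poisson x = 0.
  rewrite mulmxBr mulmxA xa mul_scalar_mx /stat scalerA divff //.
  by rewrite scale1r subrr.
rewrite /reset mulmxDl -mulmxA xF mulmx0 addr0 /poisson mulmxBr mulmxA.
have -> : M *m A = A - 1%:M by rewrite {2}resolventKl addrC addKr.
have -> : M *m a = a - ones by rewrite {2}exit_timeE addrC addKr.
by rewrite mulmxBl opprB -[in RHS]addrA [RHS]addrAC [in RHS]addrA addrA.
Qed.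

End Resolvent.

(** * Quadratic Lyapunov forms from the spectrum of a matrix *)

Section Lyapunov.
Context {R : realType}.
Local Notation C := R[i].
Local Notation toC := (real_complex R).
Local Notation normc := ComplexField.Normc.normc.

Lemma Re_le_normc (z : C) : complex.Re z <= normc z.
Proof.
apply: le_trans (ler_norm _) _.
by rewrite -lecR; apply: normc_ge_Re.
Qed.

Lemma sqr_normcE (z : C) : normc z ^+ 2 = complex.Re z ^+ 2 + complex.Im z ^+ 2.
Proof. by case: z => a b /=; rewrite sqr_sqrtr // addr_ge0 // sqr_ge0. Qed.

Lemma Re_mul_conj (z w : C) :
  complex.Re (z * conjc w) =
  complex.Re z * complex.Re w + complex.Im z * complex.Im w.
Proof. by case: z w => a b [c e] /=; rewrite mulrN opprK. Qed.

Lemma normc_ge0 (z : C) : 0 <= normc z.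
Proof. by case: z => a b /=; rewrite sqrtr_ge0. Qed.

Lemma normc_conjc (z : C) : normc (conjc z) = normc z.
Proof. by case: z => a b /=; rewrite sqrrN. Qed.

Lemma Re_sum (I : finType) (F : I -> C) :
  complex.Re (\sum_i F i) = \sum_i complex.Re (F i).
Proof. by elim/big_rec2: _ => // i x [a b] _ /= <-; case: (F i). Qed.

Lemma Im_sum (I : finType) (F : I -> C) :
  complex.Im (\sum_i F i) = \sum_i complex.Im (F i).
Proof. by elim/big_rec2: _ => // i x [a b] _ /= <-; case: (F i). Qed.

(* Weighting the k-th coordinate by g ^ k with g large makes the strictly
   triangular part of T negligible. *)
Lemma triangular_form n (T : 'M[C]_n) (b0 b : R) : b0 < b ->
  (forall i j : 'I_n, (i < j)%N -> T i j = 0) ->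
  (forall k, complex.Re (T k k) <= b0) ->
  exists2 e : 'I_n -> R, forall k, 1 <= e k &
  forall v : 'rV[C]_n,
    \sum_k e k * complex.Re ((v *m T) 0 k * conjc (v 0 k)) <=
    b * \sum_k e k * normc (v 0 k) ^+ 2.
Proof.
move=> b0b trigT diagT.
pose m : R := 1 + \sum_i \sum_j normc (T i j).
have m_ge i j : normc (T i j) <= m.
  rewrite /m (bigD1 i) //= (bigD1 j) //=.
  rewrite -[leLHS]add0r lerD // -[leLHS]addr0 lerD ?lerDl //.
    by rewrite sumr_ge0 // => l _; rewrite normc_ge0.
  by rewrite sumr_ge0 // => k _; rewrite sumr_ge0 // => l _; rewrite normc_ge0.
have m0 : 0 < m.
  rewrite /m ltr_pwDl // sumr_ge0 // => k _; rewrite sumr_ge0 // => l _.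
  by rewrite normc_ge0.
have [n0|n0] := posnP n.
  exists (fun=> 1) => // v.
  by rewrite !big1 ?mulr0 // => k; have := ltn_ord k; rewrite {2}n0.
have nR : 0 < n%:R :> R by rewrite ltr0n.
(* Each ordered pair (k, l) will cost [de] times its two weighted squares; summed over all pairs
   this is [2 * n * de] times the form, which is exactly the slack b - b0. *)
have [de de0 hde] : exists2 de : R, 0 < de & de * (2 * n%:R) = b - b0.
  exists ((b - b0) / (2 * n%:R)); first by rewrite divr_gt0 ?subr_gt0 // mulr_gt0.
  by rewrite divfK // gt_eqF // mulr_gt0.
(* This makes the discriminant of [de * p ^+ 2 - m * p * q + de * g * q ^+ 2] non-positive, so that
   an off-diagonal term is absorbed by the squares of weights in ratio at least [g]. *)
pose g : R := 1 + m ^+ 2 / (4 * de ^+ 2).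
have g1 : 1 <= g by rewrite /g lerDl divr_ge0 ?sqr_ge0 // mulr_ge0 ?sqr_ge0.
have hg : m ^+ 2 <= 4 * de ^+ 2 * g.
  rewrite (_ : 4 * de ^+ 2 * g = 4 * de ^+ 2 + m ^+ 2).
    by rewrite lerDr mulr_ge0 ?sqr_ge0.
  by rewrite /g; field; rewrite gt_eqF.
pose e (k : 'I_n) : R := g ^+ k.
have e1 k : 1 <= e k by apply: exprn_ege1.
exists e => // v.
pose N k := normc (v 0 k).
have N0 k : 0 <= N k by rewrite normc_ge0.
have key k l : k != l ->
    e k * complex.Re (v 0 l * T l k * conjc (v 0 k)) <=
    de * (e k * N k ^+ 2 + e l * N l ^+ 2).
  have pos : 0 <= de * (e k * N k ^+ 2 + e l * N l ^+ 2).
    by rewrite mulr_ge0 ?(ltW de0) // addr_ge0 // mulr_ge0 ?sqr_ge0 ?(le_trans ler01).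
  rewrite neq_ltn => /orP [kl|lk]; last first.
    by rewrite trigT // mulr0 mul0r mulr0.
  have ekl : g * e k <= e l by rewrite /e -exprS ler_weXn2l.
  have : complex.Re (v 0 l * T l k * conjc (v 0 k)) <= N l * m * N k.
    apply: le_trans (Re_le_normc _) _.
    by rewrite !ComplexField.Normc.normcM normc_conjc !(ler_wpM2r, ler_wpM2l) ?normc_ge0.
  have := e1 k; have := N0 l; have := N0 k.
  set x := complex.Re _; move: (N k) (N l) (e k) (e l) ekl {pos} => p q ek el.
  move=> ekl p0 q0 ek1 hx.
  have am : q * m * p <= de * p ^+ 2 + de * g * q ^+ 2.
    rewrite -(ler_pM2l (_ : 0 < 4 * de)) ?mulr_gt0 //.
    have : 0 <= (2 * de * p - m * q) ^+ 2 by rewrite sqr_ge0.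
    have : m ^+ 2 * q ^+ 2 <= 4 * de ^+ 2 * g * q ^+ 2.
      by rewrite ler_wpM2r // sqr_ge0.
    by move=> *; nra.
  apply: (@le_trans _ _ (ek * (de * p ^+ 2 + de * g * q ^+ 2))).
    by rewrite ler_wpM2l ?(le_trans ler01) // (le_trans hx).
  have : de * q ^+ 2 * (g * ek) <= de * q ^+ 2 * el.
    by rewrite ler_wpM2l // mulr_ge0 ?sqr_ge0 // ltW.
  by move=> *; nra.
have expand k : e k * complex.Re ((v *m T) 0 k * conjc (v 0 k)) =
    \sum_l e k * complex.Re (v 0 l * T l k * conjc (v 0 k)).
  by rewrite mxE mulr_suml Re_sum mulr_sumr.
under eq_bigr => k _ do rewrite expand.
pose D := \sum_k e k * N k ^+ 2.
apply: (@le_trans _ _ (\sum_k \sum_l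
   ((if l == k then b0 * (e k * N k ^+ 2) else 0)
    + de * (e k * N k ^+ 2 + e l * N l ^+ 2)))).
  apply: ler_sum => k _; apply: ler_sum => l _; case: eqVneq => [->|nkl].
    rewrite ler_wpDr //.
      by rewrite mulr_ge0 ?(ltW de0) // addr_ge0 // mulr_ge0 ?sqr_ge0 ?(le_trans ler01).
    rewrite mulrCA ler_wpM2l ?(le_trans ler01) //.
    rewrite (_ : complex.Re _ = complex.Re (T k k) * N k ^+ 2).
      by rewrite ler_wpM2r ?sqr_ge0.
    rewrite /N sqr_normcE; case: (v 0 k) (T k k) => x y [z t] /=; ring.
  by rewrite add0r key // eq_sym.
rewrite -/D.
under eq_bigr => k _ do rewrite big_split /= -big_mkcond big_pred1_eq
  -mulr_sumr big_split /= sumr_const card_ord -/D.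
rewrite big_split /= -!mulr_sumr big_split /= sumr_const card_ord sumrMnl -/D.
rewrite -mulr2n -mulrnA -mulr_natr natrM.
rewrite (_ : de * (D * _) = (b - b0) * D).
  by rewrite -mulrDl addrC subrK.
by rewrite -hde; ring.
Qed.

End Lyapunov.

Section LyapunovForm.
Context {R : realType} {d : nat}.
Local Notation C := R[i].
Local Notation toC := (real_complex R).
Local Notation normc := ComplexField.Normc.normc.
Local Open Scope sesquilinear_scope.

Lemma norm1_ge0 (x : 'rV[R]_d) : 0 <= norm1 x.
Proof. by apply: sumr_ge0. Qed.

Lemma sqr_norm1_le (x : 'rV[R]_d) :
  norm1 x ^+ 2 <= d%:R * \sum_i x 0 i ^+ 2.
Proof.
rewrite expr2 /norm1 mulr_suml.
apply: (@le_trans _ _ (\sum_(i < d) \sum_(j < d)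
  (2^-1 * (x 0 i ^+ 2) + 2^-1 * (x 0 j ^+ 2)))).
  apply: ler_sum => i _; rewrite mulr_sumr; apply: ler_sum => j _.
  rewrite -(real_normK (num_real (x 0 i))) -(real_normK (num_real (x 0 j))).
  have : 0 <= (`|x 0 i| - `|x 0 j|) ^+ 2 by rewrite sqr_ge0.
  move: `|_| `|_| => p q; move=> ?; nra.
under eq_bigr => i _ do rewrite big_split /= -mulr_sumr sumr_const card_ord.
rewrite big_split /= sumr_const card_ord -!mulr_sumr sumrMnl -mulrnAr -mulrDr.
by rewrite -[(\sum_i _) *+ d]mulr_natl; set s := d%:R * _; lra.
Qed.

Lemma Re_mulmx (w : 'rV[R]_d) (S : 'M[C]_d) k :
  complex.Re ((map_mx toC w *m S) 0 k) = (w *m map_mx (@complex.Re R) S) 0 k.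
Proof.
rewrite !mxE Re_sum; apply: eq_bigr => i _; rewrite !mxE.
by case: (S i k) => x y /=; rewrite mul0r subr0.
Qed.

Lemma Im_mulmx (w : 'rV[R]_d) (S : 'M[C]_d) k :
  complex.Im ((map_mx toC w *m S) 0 k) = (w *m map_mx (@complex.Im R) S) 0 k.
Proof.
rewrite !mxE Im_sum; apply: eq_bigr => i _; rewrite !mxE.
by case: (S i k) => x y /=; rewrite mul0r addr0.
Qed.

(** In a unitary basis triangularising [B], the weighted norm of [triangular_form] is a Hermitian
    form; [Q] is the matrix of its restriction to real vectors, the real and imaginary parts of the
    coordinates contributing separately. *)
Lemma lyapunov_form (B : 'M[R]_d) (b0 b : R) : (0 < d)%N -> b0 < b ->
  (forall z : C, eigenvalue (map_mx toC B) z -> complex.Re z <= b0) ->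
  exists Q : 'M[R]_d, exists c : R,
  [/\ 0 < c, Q^T = Q,
      forall w : 'rV[R]_d, c * norm1 w ^+ 2 <= (w *m Q *m w^T) 0 0 &
      forall w : 'rV[R]_d,
        (w *m B *m Q *m w^T) 0 0 <= b * (w *m Q *m w^T) 0 0].
Proof.
move=> d0 b0b hB; pose Bc := map_mx toC B.
have [P uP] := Schur Bc d0; rewrite /similar_to /= conjymx // => trigT.
pose S := P^t*; pose T := P *m Bc *m S; rewrite -/S -/T in trigT.
have PS : P *m S = 1%:M by apply/unitarymxP.
have SP : S *m P = 1%:M by apply: mulmx1C.
have diagT k : complex.Re (T k k) <= b0.
  apply: hB.
  have : eigenvalue T (T k k).
    by rewrite eigenvalue_root_char char_poly_trig // (bigD1 k) //= rootM root_XsubC eqxx.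
  case/eigenvalueP => y hy y0; apply/eigenvalueP; exists (y *m P).
    rewrite -[_ *m map_mx _ _]mulmx1 -SP !mulmxA -/Bc.
    rewrite -[y *m P *m Bc *m S]mulmxA -[y *m P *m _]mulmxA.
    by rewrite [P *m (Bc *m S)]mulmxA -/T hy scalemxAl.
  apply: contraNneq y0 => yP0.
  by rewrite -[y]mulmx1 -PS mulmxA yP0 mul0mx.
have [e e1 he] := triangular_form b0b (is_trig_mxP trigT) diagT.
pose a := map_mx (@complex.Re R) S; pose a' := map_mx (@complex.Im R) S.
pose E := diag_mx (\row_k e k).
pose Q := a *m E *m a^T + a' *m E *m a'^T.
have vRe w := Re_mulmx w S; have vIm w := Im_mulmx w S.
have quad (w w' : 'rV[R]_d) : (w *m Q *m w'^T) 0 0 =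
    \sum_k e k * complex.Re ((map_mx toC w *m S) 0 k *
                             conjc ((map_mx toC w' *m S) 0 k)).
  have diagE (f : 'M[R]_d) : (w *m (f *m E *m f^T) *m w'^T) 0 0 =
      \sum_k e k * ((w *m f) 0 k * (w' *m f) 0 k).
    rewrite !mulmxA -mulmxA -trmx_mul mxE; apply: eq_bigr => k _.
    by rewrite mul_mx_diag !mxE mulrAC mulrC.
  rewrite /Q mulmxDr mulmxDl mxE !diagE -big_split /=; apply: eq_bigr => k _.
  by rewrite Re_mul_conj !vRe !vIm mulrDr.
have nrm (w : 'rV[R]_d) k : 0 <= normc ((map_mx toC w *m S) 0 k) ^+ 2.
  by rewrite sqr_ge0.
have quadd (w : 'rV[R]_d) : (w *m Q *m w^T) 0 0 =
    \sum_k e k * normc ((map_mx toC w *m S) 0 k) ^+ 2.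
  rewrite quad; apply: eq_bigr => k _; congr (_ * _).
  by rewrite Re_mul_conj sqr_normcE !expr2.
have parseval (w : 'rV[R]_d) :
    \sum_k normc ((map_mx toC w *m S) 0 k) ^+ 2 = \sum_i w 0 i ^+ 2.
  have : (map_mx toC w *m S) *m (map_mx toC w *m S) ^t* =
      map_mx toC w *m (map_mx toC w)^T.
    rewrite trmx_mul map_mxM mulmxA -[_ *m S *m _]mulmxA.
    rewrite [S ^T ^ _](_ : _ = P) ?SP ?mulmx1.
      congr (_ *m _); apply/matrixP => i j; rewrite !mxE.
      by exact: conjc_real.
    by rewrite /S trmxCK.
  move=> /(congr1 (fun z : 'M[C]_1 => complex.Re (z 0 0))).
  rewrite !mxE !Re_sum => e2.
  transitivity (\sum_k complex.Re ((map_mx toC w *m S) 0 k *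
                         conjc ((map_mx toC w *m S) 0 k))).
    by apply: eq_bigr => k _; rewrite Re_mul_conj sqr_normcE !expr2.
  transitivity (\sum_k complex.Re ((map_mx toC w) 0 k * (map_mx toC w)^T k 0)).
    by rewrite -e2; apply: eq_bigr => k _; rewrite !mxE.
  by apply: eq_bigr => k _; rewrite !mxE /= mul0r subr0.
(* The weights are at least 1 and a unitary basis preserves the Euclidean norm, so 1/d is the
   constant comparing it with [norm1]. *)
exists Q, (d%:R)^-1; split.
- by rewrite invr_gt0 ltr0n.
- rewrite /Q linearD /= !trmx_mul !trmxK tr_diag_mx !mulmxA //.
- move=> w; rewrite ler_pdivrMl ?ltr0n //.
  apply: le_trans (sqr_norm1_le w) _; rewrite ler_wpM2l //.
  rewrite quadd -parseval; apply: ler_sum => k _.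
  by rewrite ler_peMl.
- move=> w; rewrite (quad (w *m B) w) quadd.
  have -> : map_mx toC (w *m B) *m S = map_mx toC w *m S *m T.
    by rewrite map_mxM /T !mulmxA -[_ *m S *m P]mulmxA SP mulmx1.
  exact: he.
Qed.

End LyapunovForm.

(** * The spectral gap of the resolvent *)

Section SpectralGap.
Context {R : realType} {d : nat}.
Local Notation C := R[i].
Local Notation toC := (real_complex R).
Variables (M : 'M[R]_d) (lam : R) (nu : 'rV[R]_d) (u : 'cV[R]_d).
Hypothesis d0 : (0 < d)%N.
Hypothesis hM : nonneg_mx M.
Hypothesis irrM : irreducible_mx M.
Hypothesis lam01 : 0 < lam < 1.
Hypothesis hnu : nu *m M = lam *: nu.
Hypothesis nu0 : forall i, 0 < nu 0 i.
Hypothesis nu1 : \sum_i nu 0 i = 1.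
Hypothesis hu : M *m u = lam *: u.
Hypothesis u0 : forall i, 0 < u i 0.
Hypothesis nuu : nu *m u = 1%:M.
Variable (lams : seq C).
Hypothesis hlams : is_spectrum M (lam%:C :: lams).
Local Notation A := (resolvent M).

Lemma lam_lt1 : lam < 1. Proof. by case/andP: lam01. Qed.

Lemma spectrum_le (z : C) : z \in lams -> complex.Re z <= lam.
Proof.
case: hlams => _ /= /order_path_min H zin.
have /H/allP/(_ z zin) : transitive (fun z w : C => `|w| <= `|z|).
  by move=> y x t /= h1 h2; exact: le_trans h2 h1.
rewrite [leRHS]ger0_norm; last by rewrite ler0c ltW //; case/andP: lam01.
move=> h; have : `|complex.Re z|%:C <= lam%:C.
  exact: le_trans (normc_ge_Re z) h.
by rewrite lecR; apply: le_trans (ler_norm _).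
Qed.

(** Inversion: 1 / (1 - z) maps the half-plane Re z <= lam into the disc with diameter
    [0, 1 / (1 - lam)], whose rightmost point is attained at z = lam only. *)
Lemma Re_resolvent_bounds (z : C) : complex.Re z <= lam ->
  0 <= Re_resolvent z /\ (z != lam%:C -> (1 - lam) * Re_resolvent z < 1).
Proof.
have := lam_lt1; case: z => x y l1 /= xl.
have pos : 0 < (1 - x) ^+ 2 + y ^+ 2.
  by rewrite ltr_pwDl ?sqr_ge0 // exprn_gt0 // subr_gt0 (le_lt_trans xl).
rewrite /Re_resolvent /= sub0r sqrrN; split.
  by rewrite divr_ge0 ?(ltW pos) // subr_ge0 ltW // (le_lt_trans xl).
rewrite eq_complex /= negb_and => h.
rewrite mulrA ltr_pdivrMr // mul1r.
have yy : 0 <= y ^+ 2 by rewrite sqr_ge0.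
case/orP: h => h.
  have xl' : x < lam by rewrite lt_neqAle h.
  have : 0 < (1 - x) * (lam - x) by rewrite mulr_gt0 ?subr_gt0 // (lt_trans xl').
  by nra.
have : 0 < y ^+ 2 by rewrite lt_neqAle eq_sym sqrf_eq0 h yy.
have : 0 <= (1 - x) * (lam - x).
  by rewrite mulr_ge0 ?subr_ge0 // ltW // (le_lt_trans xl).
by nra.
Qed.

Lemma map_Re_mulmx (w : 'rV[C]_d) (N : 'M[R]_d) :
  map_mx (@complex.Re R) (w *m map_mx toC N) = map_mx (@complex.Re R) w *m N.
Proof.
apply/rowP => k; rewrite !mxE Re_sum; apply: eq_bigr => i _; rewrite !mxE.
by case: (w 0 i) => x y /=; rewrite mulr0 subr0.
Qed.

Lemma map_Im_mulmx (w : 'rV[C]_d) (N : 'M[R]_d) :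
  map_mx (@complex.Im R) (w *m map_mx toC N) = map_mx (@complex.Im R) w *m N.
Proof.
apply/rowP => k; rewrite !mxE Im_sum; apply: eq_bigr => i _; rewrite !mxE.
by case: (w 0 i) => x y /=; rewrite mulr0 add0r.
Qed.

Definition deflated : 'M[R]_d := A - (1 - lam)^-1 *: (u *m nu).

(** The default value 0 stands for the eigenvalue 0 that deflation substitutes for the Perron one.
    Skipping entries equal to lam makes geometric simplicity of lam sufficient. *)
Definition gap_bound : R :=
  \big[Num.max/0]_(z <- lams | z != lam%:C) Re_resolvent z.

Lemma complex_eigen_simple (w : 'rV[C]_d) :
  w *m map_mx toC M = lam%:C *: w -> w *m map_mx toC u = 0 -> w = 0.
Proof.
move=> hw wu.
have simple := row_eigen_simple hM irrM hnu nu0 u0.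
have wRe : map_mx (@complex.Re R) w = 0.
  apply: simple.
    rewrite -map_Re_mulmx hw; apply/rowP => i; rewrite !mxE.
    by case: (w 0 i) => x y /=; rewrite mul0r subr0.
  apply/matrixP => i j; rewrite !ord1.
  have := congr1 (fun z : 'M[C]_1 => complex.Re (z 0 0)) wu.
  rewrite !mxE Re_sum => e; rewrite -[RHS]/(complex.Re (0 : C)) -e.
  apply: eq_bigr => k _; rewrite !mxE.
  by case: (w 0 k) => x y /=; rewrite mulr0 subr0.
have wIm : map_mx (@complex.Im R) w = 0.
  apply: simple.
    rewrite -map_Im_mulmx hw; apply/rowP => i; rewrite !mxE.
    by case: (w 0 i) => x y /=; rewrite mul0r addr0.
  apply/matrixP => i j; rewrite !ord1.
  have := congr1 (fun z : 'M[C]_1 => complex.Im (z 0 0)) wu.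
  rewrite !mxE Im_sum => e; rewrite -[RHS]/(complex.Im (0 : C)) -e.
  apply: eq_bigr => k _; rewrite !mxE.
  by case: (w 0 k) => x y /=; rewrite mulr0 add0r.
apply/rowP => i; have /rowP/(_ i) := wRe; have /rowP/(_ i) := wIm.
by rewrite !mxE; case: (w 0 i) => x y /= -> ->.
Qed.

(** As [deflated *m u = 0], an eigenvector for z != 0 is orthogonal to [u]; there [deflated] acts as
    the resolvent, so 1 - 1/z is an eigenvalue of [M], and not lam by simplicity. *)
Lemma eigenvalue_deflated (z : C) : eigenvalue (map_mx toC deflated) z ->
  complex.Re z <= gap_bound.
Proof.
case/eigenvalueP => w hw wn0.
have l1 : 1 - lam != 0 by rewrite subr_eq0 gt_eqF ?lam_lt1.
have Cu : deflated *m u = 0.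
  rewrite mulmxBl (resolvent_u hM lam_lt1 hu u0) -scalemxAl -mulmxA nuu mulmx1.
  by rewrite subrr.
have g0 : 0 <= gap_bound by apply: bigmax_ge_id.
have [->//|zn0] := eqVneq z 0.
have wu : w *m map_mx toC u = 0.
  have : z *: (w *m map_mx toC u) = 0.
    by rewrite scalemxAl -hw -mulmxA -map_mxM Cu map_mx0 mulmx0.
  by move/eqP; rewrite scaler_eq0 (negPf zn0) => /eqP.
have wA : w *m map_mx toC A = z *: w.
  rewrite -hw /deflated map_mxB map_mxZ map_mxM mulmxBr -scalemxAr mulmxA.
  by rewrite wu mul0mx scaler0 subr0.
have wM : w *m map_mx toC M = (1 - z^-1) *: w.
  have : w = z *: (w *m map_mx toC (1%:M - M)).
    rewrite scalemxAl -wA -mulmxA -map_mxM mulVmx ?map_mx1 ?mulmx1 //.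
    exact: (resolvent_unit hM lam_lt1 hu u0).
  rewrite map_mxB map_mx1 mulmxBr mulmx1 scalerBr => e.
  rewrite scalerBl scale1r {3}e scalerBr !scalerA mulVf // !scale1r.
  by rewrite opprB addrC subrK.
have : eigenvalue (map_mx toC M) (1 - z^-1) by apply/eigenvalueP; exists w.
rewrite eigenvalue_root_char; case: hlams => -> _.
rewrite root_prod_XsubC inE.
have [zl|zl /=] := eqVneq (1 - z^-1) lam%:C.
  by rewrite zl in wM; rewrite (complex_eigen_simple wM wu) eqxx in wn0.
move=> zin; have -> : z = (1 - (1 - z^-1))^-1 by rewrite opprB addrC subrK invrK.
exact: (@Order.TotalTheory.le_bigmax_seq _ _ _ lams 0 _ (fun z => z != lam%:C)
  (@Re_resolvent R) zin zl).
Qed.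

Lemma gap_bound_lt : (1 - lam) * gap_bound < 1.
Proof.
rewrite mulrC -ltr_pdivlMr ?subr_gt0 ?lam_lt1 //.
rewrite /gap_bound big_seq_cond; apply: bigmax_lt.
  by rewrite divr_gt0 // subr_gt0 lam_lt1.
move=> z /andP [zin zl]; rewrite ltr_pdivlMr ?subr_gt0 ?lam_lt1 // mulrC.
by apply: (Re_resolvent_bounds (spectrum_le zin)).2.
Qed.

(** An inequality is enough: a gap larger than [Rgap] only enlarges the range of admissible
    rates. *)
Lemma Rgap_le : Rgap lam lams <= 1 - (1 - lam) * gap_bound.
Proof.
have l : 0 <= 1 - lam by rewrite subr_ge0 ltW // lam_lt1.
rewrite /Rgap lerB // ler_wpM2l // /gap_bound big_seq_cond; apply: bigmax_le.
  apply: le_trans (bigmax_ge_id _ _ _ _).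
  case: lams spectrum_le => [|z s] h /=.
    by apply: (Re_resolvent_bounds _).1 => /=; rewrite ltW //; case/andP: lam01.
  by apply: (Re_resolvent_bounds _).1; apply: h; rewrite inE eqxx.
by move=> z /andP [zin _]; apply: le_bigmax_seq.
Qed.

Lemma gap_form : exists r : R,
  [/\ 0 < r, Rgap lam lams <= r &
   forall b, 1 - r < (1 - lam) * b -> exists S : 'M[R]_d, exists c : R,
   [/\ 0 < c, S^T = S,
       forall x, simplex x -> c * norm1 (x - nu) ^+ 2 <= (x *m S *m x^T) 0 0 &
       forall x : 'rV[R]_d,
         (x *m A *m S *m x^T) 0 0 <= b * (x *m S *m x^T) 0 0]].
Proof.
exists (1 - (1 - lam) * gap_bound); split; [|exact: Rgap_le|].
  by rewrite subr_gt0 gap_bound_lt.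
move=> b; rewrite opprB addrC subrK ltr_pM2l ?subr_gt0 ?lam_lt1 // => hb.
have [Q [c [c0 QT hc hQ]]] := lyapunov_form d0 hb eigenvalue_deflated.
pose Pi : 'M[R]_d := 1%:M - u *m nu.
have APi : A *m Pi = Pi *m deflated.
  rewrite /Pi mulmxBr mulmxBl mulmx1 mul1mx mulmxA (resolvent_u hM lam_lt1 hu u0).
  rewrite -scalemxAl -/deflated /deflated mulmxBr -mulmxA
    (nu_resolvent hM lam_lt1 hnu hu u0).
  by rewrite -!scalemxAr mulmxA -[u *m nu *m u]mulmxA nuu mulmx1 subrr subr0.
(* [Pi] kills [nu] and intertwines the resolvent with [deflated]. The factor 4 is the square of 2 in
   |x - nu| <= 2 |x Pi|: the total mass of x Pi is 1 - xu, and x - nu = x Pi - (1 - xu) nu. *)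
exists (Pi *m Q *m Pi^T), (c / 4); split.
- by rewrite divr_gt0.
- by rewrite !trmx_mul trmxK QT mulmxA.
- move=> x [x0 x1]; set y := x *m Pi.
  have -> : x *m (Pi *m Q *m Pi^T) *m x^T = y *m Q *m y^T.
    by rewrite /y trmx_mul !mulmxA.
  apply: le_trans (hc y); rewrite mulrAC ler_pdivrMr // -mulrA ler_pM2l //.
  have -> : norm1 y ^+ 2 * 4 = (2 * norm1 y) ^+ 2 by ring.
  rewrite ler_sqr ?nnegrE ?mulr_ge0 ?norm1_ge0 //.
  pose t := (x *m u) 0 0.
  have yE i : y 0 i = x 0 i - t * nu 0 i.
    have xu : x *m u = t%:M by rewrite [LHS]mx11_scalar.
    by rewrite /y /Pi mulmxBr mulmx1 mulmxA xu mul_scalar_mx !mxE.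
  have ys : \sum_i y 0 i = 1 - t.
    under eq_bigr => i _ do rewrite yE.
    by rewrite big_split /= x1 sumrN -mulr_sumr nu1 mulr1.
  have yt : `|1 - t| <= norm1 y by rewrite -ys ler_norm_sum.
  apply: (@le_trans _ _ (\sum_i (`|y 0 i| + `|1 - t| * nu 0 i))).
    apply: ler_sum => i _; rewrite [(x - nu) _ _]mxE [(- nu) _ _]mxE.
    have -> : x 0 i - nu 0 i = y 0 i - (1 - t) * nu 0 i by rewrite yE; ring.
    by apply: le_trans (ler_normB _ _) _; rewrite normrM (ger0_norm (ltW (nu0 i))).
  by rewrite big_split /= -mulr_sumr nu1 mulr1 mulr_natl mulr2n lerD2l.
- move=> x.
  have -> : x *m A *m (Pi *m Q *m Pi^T) *m x^T =
            x *m Pi *m deflated *m Q *m (x *m Pi)^T.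
    by rewrite trmx_mul !mulmxA -[x *m A *m Pi]mulmxA APi !mulmxA.
  have -> : x *m (Pi *m Q *m Pi^T) *m x^T = x *m Pi *m Q *m (x *m Pi)^T.
    by rewrite trmx_mul !mulmxA.
  exact: hQ.
Qed.

End SpectralGap.

(** * Calculus on the simplex with explicit gradients *)

Section SmoothOnSimplex.
Context {R : realType} {d : nat}.
Implicit Types (f g : 'rV[R]_d -> R) (D E : 'I_d -> 'rV[R]_d -> R).
Implicit Types (x y h : 'rV[R]_d).

Lemma norm1_coord x k : `|x 0 k| <= norm1 x.
Proof.
by rewrite /norm1 (bigD1 k) //= lerDl sumr_ge0.
Qed.

Lemma norm1_triangle x y : norm1 (x + y) <= norm1 x + norm1 y.
Proof.
rewrite /norm1 -big_split /=; apply: ler_sum => i _.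
by rewrite mxE ler_normD.
Qed.

Lemma norm1Z (c : R) x : norm1 (c *: x) = `|c| * norm1 x.
Proof.
by rewrite /norm1 mulr_sumr; apply: eq_bigr => i _; rewrite mxE normrM.
Qed.

Lemma norm1_simplex x : simplex x -> norm1 x = 1.
Proof. by case=> x0 <-; apply: eq_bigr => i _; rewrite ger0_norm. Qed.

Lemma norm1B_simplex x y : simplex x -> simplex y -> norm1 (x - y) <= 2.
Proof.
move=> hx hy; apply: le_trans (norm1_triangle _ _) _.
by rewrite -scaleN1r norm1Z normrN1 mul1r !norm1_simplex.
Qed.

Definition bdLip f := exists C : R, [/\ 0 <= C,
  forall x, simplex x -> `|f x| <= C &
  forall x y, simplex x -> simplex y -> `|f x - f y| <= C * norm1 (x - y)].

Lemma bdLip_cst c : bdLip (fun=> c).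
Proof.
exists `|c|; split=> // x y _ _.
by rewrite subrr normr0 mulr_ge0 ?norm1_ge0.
Qed.

Lemma bdLipD f g : bdLip f -> bdLip g -> bdLip (fun x => f x + g x).
Proof.
move=> [C [C0 hf lf]] [C' [C'0 hg lg]]; exists (C + C'); split.
- exact: addr_ge0.
- by move=> x hx; rewrite (le_trans (ler_normD _ _)) // lerD ?hf ?hg.
- move=> x y hx hy; rewrite opprD addrACA (le_trans (ler_normD _ _)) //.
  by rewrite mulrDl lerD ?lf ?lg.
Qed.

Lemma bdLipM f g : bdLip f -> bdLip g -> bdLip (fun x => f x * g x).
Proof.
move=> [C [C0 hf lf]] [C' [C'0 hg lg]]; exists (C * C' + C * C'); split.
- by rewrite addr_ge0 // mulr_ge0.
- move=> x hx; rewrite normrM (@le_trans _ _ (C * C')) //.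
    by rewrite ler_pM ?hf ?hg.
  by rewrite lerDl mulr_ge0.
- move=> x y hx hy.
  have -> : f x * g x - f y * g y = (f x - f y) * g x + f y * (g x - g y) by ring.
  rewrite (le_trans (ler_normD _ _)) // !normrM mulrDl.
  rewrite lerD //; last by rewrite -mulrA ler_pM ?hf ?lg.
  by rewrite mulrAC ler_pM ?hg ?lf.
Qed.

Lemma bdLipN f : bdLip f -> bdLip (fun x => - f x).
Proof.
move=> [C [C0 hf lf]]; exists C; split=> // [x hx|x y hx hy].
  by rewrite normrN hf.
by rewrite -opprD normrN lf.
Qed.

Lemma bdLipB f g : bdLip f -> bdLip g -> bdLip (fun x => f x - g x).
Proof. by move=> hf hg; apply: bdLipD => //; apply: bdLipN. Qed.

Lemma bdLip_sum (I : Type) (r : seq I) (F : I -> 'rV[R]_d -> R) :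
  (forall i, bdLip (F i)) -> bdLip (fun x => \sum_(i <- r) F i x).
Proof.
move=> h; elim: r => [|i r IH].
  by have := bdLip_cst 0; congr bdLip; apply/funext => x; rewrite big_nil.
have := bdLipD (h i) IH; congr bdLip; apply/funext => x.
by rewrite big_cons.
Qed.

Lemma bdLip_coord k : bdLip (fun x => x 0 k).
Proof.
exists 1; split=> // [x hx|x y _ _].
  by rewrite -(norm1_simplex hx) norm1_coord.
by rewrite mul1r; have := norm1_coord (x - y) k; rewrite !mxE.
Qed.

Lemma bdLip_mulmx n (A : 'M[R]_(d, n)) k : bdLip (fun x => (x *m A) 0 k).
Proof.
have := bdLip_sum (index_enum _) (fun i => bdLipM (bdLip_coord i) (bdLip_cst (A i k))).
by congr bdLip; apply/funext => x; rewrite mxE.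
Qed.

Lemma bdLipV f c : 0 < c -> (forall x, simplex x -> c <= f x) -> bdLip f ->
  bdLip (fun x => (f x)^-1).
Proof.
move=> c0 fc [C [C0 hf lf]].
have f0 x : simplex x -> 0 < f x by move=> /fc; apply: lt_le_trans.
have fi x : simplex x -> (f x)^-1 <= c^-1.
  by move=> hx; rewrite lef_pV2 ?posrE ?f0 ?fc.
exists (c^-1 + c^-1 * c^-1 * C); split.
- by rewrite addr_ge0 ?mulr_ge0 ?invr_ge0 // ltW.
- move=> x hx; rewrite ger0_norm ?invr_ge0 ?(ltW (f0 _ hx)) //.
  by rewrite (le_trans (fi _ hx)) // lerDl !mulr_ge0 ?invr_ge0 // ltW.
- move=> x y hx hy.
  have -> : (f x)^-1 - (f y)^-1 = (f x)^-1 * (f y)^-1 * (f y - f x).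
    by field; rewrite !gt_eqF ?f0.
  rewrite mulrDl ler_wpDl //.
    by rewrite mulr_ge0 ?norm1_ge0 ?invr_ge0 // ltW.
  have fp z : simplex z -> 0 <= (f z)^-1 by move=> /f0 /ltW; rewrite invr_ge0.
  rewrite !normrM (ger0_norm (fp _ hx)) (ger0_norm (fp _ hy)) -[leRHS]mulrA.
  rewrite ler_pM ?mulr_ge0 ?fp //; first by rewrite ler_pM ?fi ?fp.
  by rewrite distrC lf.
Qed.

Definition grad D x h : R := \sum_k h 0 k * D k x.

(** Differentiability through the quadratic Taylor remainder, with the gradient as data: the
    one-step estimate needs just this, and it passes to sums, products and inverses of functions
    bounded below. *)
Definition smooth f D := [/\ bdLip f, forall k, bdLip (D k) &
  exists2 C : R, 0 <= C & forall x y, simplex x -> simplex y ->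
    `|f y - f x - grad D x (y - x)| <= C * norm1 (y - x) ^+ 2].

Lemma gradD D E x h :
  grad (fun k x => D k x + E k x) x h = grad D x h + grad E x h.
Proof.
by rewrite /grad -big_split /=; apply: eq_bigr => k _; rewrite mulrDr.
Qed.

Lemma gradM f D x h :
  grad (fun k x => f x * D k x) x h = f x * grad D x h.
Proof.
by rewrite /grad mulr_sumr; apply: eq_bigr => k _; rewrite mulrCA.
Qed.

Lemma smooth_cst c : smooth (fun=> c) (fun _ => fun=> 0).
Proof.
split; [exact: bdLip_cst|by move=> k; exact: bdLip_cst|exists 0 => // x y _ _].
rewrite subrr sub0r normrN mul0r /grad big1 ?normr0 // => k _.
by rewrite mulr0.
Qed.

Lemma smooth_linear (v : 'cV[R]_d) :
  smooth (fun x => (x *m v) 0 0) (fun k => fun=> v k 0).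
Proof.
split; [exact: bdLip_mulmx|by move=> k; exact: bdLip_cst|exists 0 => // x y _ _].
rewrite mul0r (_ : _ - _ = 0) ?normr0 //.
rewrite /grad; have -> : \sum_k (y - x) 0 k * v k 0 = ((y - x) *m v) 0 0.
  by rewrite mxE.
have -> : ((y - x) *m v) 0 0 = (y *m v) 0 0 - (x *m v) 0 0.
  by rewrite mulmxBl !mxE.
by rewrite subrr.
Qed.

Lemma smoothD f D g E : smooth f D -> smooth g E ->
  smooth (fun x => f x + g x) (fun k x => D k x + E k x).
Proof.
move=> [hf hD [C C0 tf]] [hg hE [C' C'0 tg]]; split.
- exact: bdLipD.
- by move=> k; apply: bdLipD.
exists (C + C'); rewrite ?addr_ge0 // => x y hx hy.
rewrite gradD mulrDl.
set a := grad _ _ _; set b := grad _ _ _.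
have -> : f y + g y - (f x + g x) - (a + b) =
  (f y - f x - a) + (g y - g x - b) by ring.
by rewrite (le_trans (ler_normD _ _)) // lerD ?tf ?tg.
Qed.

Lemma smoothM f D g E : smooth f D -> smooth g E ->
  smooth (fun x => f x * g x) (fun k x => g x * D k x + f x * E k x).
Proof.
move=> [hf hD [C C0 tf]] [hg hE [C' C'0 tg]]; split.
- exact: bdLipM.
- by move=> k; apply: bdLipD; apply: bdLipM.
have [B [B0 bf lf]] := hf; have [B' [B'0 bg lg]] := hg.
exists (B' * C + B * C' + B * B'); first by rewrite !addr_ge0 // mulr_ge0.
move=> x y hx hy.
rewrite gradD !gradM.
set a := grad _ _ _; set b := grad _ _ _.
have -> : f y * g y - f x * g x - (g x * a + f x * b) =
  g x * (f y - f x - a) + f x * (g y - g x - b) + (f y - f x) * (g y - g x).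
  by ring.
rewrite (le_trans (ler_normD _ _)) // [leRHS]mulrDl lerD //.
  rewrite (le_trans (ler_normD _ _)) // [leRHS]mulrDl !normrM.
  rewrite -[X in _ <= X + _]mulrA -[X in _ <= _ + X]mulrA lerD //.
    by rewrite ler_pM ?bg ?tf.
  by rewrite ler_pM ?bf ?tg.
rewrite normrM expr2 mulrACA ler_pM ?lf ?lg //.
Qed.

Lemma smoothV f D c : 0 < c -> (forall x, simplex x -> c <= f x) ->
  smooth f D ->
  smooth (fun x => (f x)^-1) (fun k x => - (f x)^-1 * (f x)^-1 * D k x).
Proof.
move=> c0 fc [hf hD [C C0 tf]]; have hi := bdLipV c0 fc hf.
have hii : bdLip (fun x => - (f x)^-1 * (f x)^-1).
  by apply: bdLipM => //; apply: bdLipN.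
split=> //; first by move=> k; apply: bdLipM.
have [B [B0 bf lf]] := hf; have [B' [B'0 bi _]] := hi.
have f0 x : simplex x -> f x != 0 by move=> /fc h; rewrite gt_eqF // (lt_le_trans c0).
exists (B' * B' * B' * (B * B) + B' * B' * C).
  by rewrite addr_ge0 // !mulr_ge0.
move=> x y hx hy.
rewrite (gradM (fun x => - (f x)^-1 * (f x)^-1)); set a := grad _ _ _.
have -> : (f y)^-1 - (f x)^-1 - - (f x)^-1 * (f x)^-1 * a =
  (f x)^-1 * (f x)^-1 * (f y)^-1 * ((f y - f x) * (f y - f x))
  - (f x)^-1 * (f x)^-1 * (f y - f x - a).
  by field; rewrite !f0.
set n := norm1 _; have n0 : 0 <= n by apply: norm1_ge0.
rewrite (le_trans (ler_normB _ _)) // [leRHS]mulrDl; apply: lerD; rewrite !normrM.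
  have -> : B' * B' * B' * (B * B) * n ^+ 2 = B' * B' * B' * ((B * n) * (B * n)).
    by ring.
  by rewrite !ler_pM ?mulr_ge0 ?bi ?lf.
by rewrite -[leRHS]mulrA !ler_pM ?mulr_ge0 ?bi ?tf.
Qed.

Lemma smoothX f D n : smooth f D ->
  smooth (fun x => f x ^+ n) (fun k x => n%:R * f x ^+ n.-1 * D k x).
Proof.
move=> h; elim: n => [|n IH].
  have := smooth_cst 1; congr smooth; apply/funext => k //.
  by apply/funext => x; rewrite !mul0r.
have := smoothM h IH; congr smooth; first by apply/funext => x; rewrite exprS.
apply/funext => k; apply/funext => x; case: n {IH} => [|n] /=.
  by rewrite expr0; ring.
by rewrite exprS -[in RHS]natr1; ring.
Qed.

Lemma smooth_quadratic (S : 'M[R]_d) : S^T = S ->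
  smooth (fun x => (x *m S *m x^T) 0 0) (fun k x => 2 * (x *m S) 0 k).
Proof.
move=> ST.
have quadE x y : (x *m S *m y^T) 0 0 = \sum_k (x *m S) 0 k * y 0 k.
  by rewrite mxE; apply: eq_bigr => k _; rewrite [y^T _ _]mxE.
split.
- have := bdLip_sum (index_enum _) (fun k => bdLipM (bdLip_mulmx S k) (bdLip_coord k)).
  by congr bdLip; apply/funext => x; rewrite quadE.
- by move=> k; apply: bdLipM (bdLip_cst _) (bdLip_mulmx _ _).
pose C := \sum_i \sum_j `|S i j|.
exists C; first by rewrite sumr_ge0 // => i _; rewrite sumr_ge0.
move=> x y hx hy; set h := y - x.
have -> : grad (fun k x => 2 * (x *m S) 0 k) x h = 2 * (x *m S *m h^T) 0 0.
  by rewrite quadE /grad mulr_sumr; apply: eq_bigr => k _; ring.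
have sym : (h *m S *m x^T) 0 0 = (x *m S *m h^T) 0 0.
  have tr11 (B : 'M[R]_1) : B^T = B by apply/matrixP => i j; rewrite !ord1 mxE.
  by rewrite -[h *m S *m x^T]tr11 !trmx_mul trmxK ST mulmxA.
have -> : (y *m S *m y^T) 0 0 = (x *m S *m x^T) 0 0 +
   2 * (x *m S *m h^T) 0 0 + (h *m S *m h^T) 0 0.
  have -> : y = x + h by rewrite /h addrC subrK.
  rewrite mulmxDl linearD /= mulmxDl !mulmxDr mxE [X in X + _ = _]mxE.
  by rewrite [X in _ + X = _]mxE sym; ring.
set a := (x *m S *m x^T) 0 0; set b := (x *m S *m h^T) 0 0.
set c := (h *m S *m h^T) 0 0; have -> : a + 2 * b + c - a - 2 * b = c by ring.
rewrite /c quadE; apply: le_trans (ler_norm_sum _ _ _) _.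
apply: (@le_trans _ _ (\sum_k \sum_i `|S i k| * norm1 h ^+ 2)).
  apply: ler_sum => k _; rewrite mxE normrM.
  apply: (@le_trans _ _ ((\sum_i `|h 0 i * S i k|) * `|h 0 k|)).
    by rewrite ler_wpM2r // ler_norm_sum.
  rewrite mulr_suml; apply: ler_sum => i _.
  rewrite normrM mulrAC mulrC ler_wpM2l // expr2.
  by rewrite ler_pM // norm1_coord.
rewrite exchange_big /C mulr_suml /=; apply: ler_sum => k _.
by rewrite mulr_suml.
Qed.

End SmoothOnSimplex.

(** * A Lyapunov function for the mean-field flow *)

Section LyapunovFunction.
Context {R : realType} {d : nat}.
Local Notation C := R[i].
Variables (M : 'M[R]_d) (lam : R) (nu : 'rV[R]_d) (u : 'cV[R]_d).
Hypothesis d0 : (0 < d)%N.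
Hypothesis hM : nonneg_mx M.
Hypothesis hM1 : forall i, (M *m ones) i 0 <= 1.
Hypothesis lam01 : 0 < lam < 1.
Hypothesis hnu : nu *m M = lam *: nu.
Hypothesis nuK : simplex nu.
Hypothesis hu : M *m u = lam *: u.
Hypothesis u0 : forall i, 0 < u i 0.
Local Notation A := (resolvent M).
Local Notation a := (exit_time M).
Local Notation mt := (mean_time M).

Let lam1 : lam < 1 := lam_lt1 lam01.

Lemma mean_time_nu : mt nu = (1 - lam)^-1.
Proof.
rewrite /mean_time /exit_time mulmxA (nu_resolvent hM lam1 hnu hu u0).
by rewrite -scalemxAl mxE mulmx_ones nuK.2 mulr1.
Qed.

Lemma bdLip_mean_timeV : bdLip (fun x => (mt x)^-1).
Proof.
by apply: (@bdLipV _ _ _ 1) => //;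
  [exact: mean_time_ge1 hM hM1 lam1 hu u0|exact: bdLip_mulmx].
Qed.

Lemma bdLip_stat k : bdLip (fun x => stat M x 0 k).
Proof.
have := bdLipM bdLip_mean_timeV (bdLip_mulmx A k).
by congr bdLip; apply/funext => x; rewrite /stat [RHS]mxE.
Qed.

Lemma linear_simplex_le (v : 'cV[R]_d) x : (forall i, 0 <= v i 0) ->
  simplex x -> (x *m v) 0 0 <= \sum_i v i 0.
Proof.
move=> v0 hx; rewrite mxE; apply: ler_sum => i _; rewrite ler_piMl //.
by rewrite -(norm1_simplex hx) (le_trans (ler_norm _)) // norm1_coord.
Qed.

Lemma linear_simplex_ge (v : 'cV[R]_d) : (forall i, 0 < v i 0) ->
  exists2 c : R, 0 < c & forall x, simplex x -> c <= (x *m v) 0 0.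
Proof.
move=> v0; pose i0 := [arg min_(k < Ordinal d0) (v k 0)]%O.
exists (v i0 0) => // x [x0 x1]; rewrite -[leLHS]mul1r -x1 mulr_suml mxE.
apply: ler_sum => i _; rewrite ler_wpM2l //.
by rewrite /i0; case: arg_minP => // i1 _; apply.
Qed.

Variables (S : 'M[R]_d) (b c : R).
Hypothesis ST : S^T = S.
Hypothesis c0 : 0 < c.
Hypothesis Sc : forall x, simplex x ->
  c * norm1 (x - nu) ^+ 2 <= (x *m S *m x^T) 0 0.
Hypothesis Sb : forall x : 'rV[R]_d,
  (x *m A *m S *m x^T) 0 0 <= b * (x *m S *m x^T) 0 0.

(** Distance from the Perron eigenvalue of the resolvent down to the growth exponent [b] of the
    form. Multiplied by the clock speed 1 - lam at [nu] and by 2, it is the decay rate near [nu]. *)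
Local Notation kappa := ((1 - lam)^-1 - b).

(* In the projective coordinate x / (x u) the mean-field flow is the linear flow
   of A - 1/(1 - lam) up to the time change 1 / (x a). *)
Lemma projective_form : exists V D, [/\ smooth V D,
  exists2 c' : R, 0 < c' & forall x, simplex x -> c' * norm1 (x - nu) ^+ 2 <= V x &
  forall x, simplex x ->
    grad D x (stat M x - x) <= - (2 * kappa) * (mt x)^-1 * V x].
Proof.
have [cu cu0 hcu] := linear_simplex_ge u0.
have sg := smoothV cu0 hcu (smooth_linear u).
have sV := smoothM (smooth_quadratic ST) (smoothM sg sg).
do 2 eexists; split; [exact: sV| |] => /=.
  pose G := \sum_i u i 0.
  have G0 : 0 < G.
    rewrite /G (bigD1 (Ordinal d0)) //= ltr_pwDl // sumr_ge0 // => i _.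
    exact: ltW.
  exists (c * (G^-1 * G^-1)); first by rewrite !mulr_gt0 ?invr_gt0.
  move=> x hx; rewrite mulrAC ler_pM ?Sc ?mulr_ge0 ?norm1_ge0 ?invr_ge0
    ?(ltW c0) ?(ltW G0) //.
  have gx : 0 < (x *m u) 0 0 by apply: lt_le_trans cu0 (hcu _ hx).
  have le : G^-1 <= ((x *m u) 0 0)^-1.
    rewrite lef_pV2 ?posrE // linear_simplex_le // => i; exact: ltW.
  by rewrite ler_pM ?invr_ge0 ?(ltW G0).
move=> x hx.
have gx : 0 < (x *m u) 0 0 by apply: lt_le_trans cu0 (hcu _ hx).
have t1 := mean_time_ge1 hM hM1 lam1 hu u0 hx.
have t0 : 0 < mt x by apply: lt_le_trans t1.
set h := stat M x - x.
have xSh : (x *m S *m h^T) 0 0 =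
    (mt x)^-1 * (x *m A *m S *m x^T) 0 0 - (x *m S *m x^T) 0 0.
  have tr11 (B : 'M[R]_1) : B^T = B by apply/matrixP => i j; rewrite !ord1 mxE.
  rewrite -[x *m S *m h^T]tr11 !trmx_mul trmxK ST mulmxA /h /stat.
  rewrite !mulmxBl -!scalemxAl; move: (_ *m x^T) (x *m S *m _) => z z'.
  by rewrite !mxE.
have hu' : (h *m u) 0 0 = (mt x)^-1 * ((1 - lam)^-1 * (x *m u) 0 0) - (x *m u) 0 0.
  rewrite /h /stat mulmxBl -scalemxAl -mulmxA (resolvent_u hM lam1 hu u0).
  by rewrite -scalemxAr; move: (x *m u) => z; rewrite !mxE.
pose p := (x *m A *m S *m x^T) 0 0; pose q := (x *m S *m x^T) 0 0.
pose i := ((x *m u) 0 0)^-1.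
set DV := (X in grad X x h).
(* V is homogeneous of degree 0, so the [- x] part of [h] contributes nothing and [mt x] acts as a
   mere change of speed. *)
have -> : grad DV x h = 2 * (mt x)^-1 * (i * i) * (p - (1 - lam)^-1 * q); last first.
  rewrite -/q -/i.
  have : 0 <= 2 * (mt x)^-1 * (i * i).
    by rewrite !mulr_ge0 ?invr_ge0 // ltW.
  have : p - (1 - lam)^-1 * q <= - kappa * q.
    by have := Sb x; rewrite -/p -/q => ?; lra.
  move=> h1 h2; apply: le_trans (ler_wpM2l h2 h1) _.
  by rewrite le_eqVlt; apply/orP; left; apply/eqP; ring.
rewrite /grad /DV.
transitivity (i * i * 2 * (x *m S *m h^T) 0 0 - 2 * q * i * i * i * (h *m u) 0 0).
  rewrite [X in _ = _ * X - _]mxE [X in _ = _ - _ * X]mxE !mulr_sumr -sumrB.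
  by apply: eq_bigr => k _; rewrite [h^T _ _]mxE -/i -/q; ring.
rewrite xSh hu' -/p -/q /i; field.
by rewrite !gt_eqF //= subr_gt0.
Qed.

(* V alone decays at the optimal rate only near nu; the high power of V / delta
   makes up for the slower clock far away from nu. *)
Lemma lyapunov_function (rho : R) : 0 < rho -> rho < 2 * kappa * (1 - lam) ->
  exists U D, [/\ smooth U D,
  exists2 c' : R, 0 < c' & forall x, simplex x -> c' * norm1 (x - nu) ^+ 2 <= U x &
  forall x, simplex x -> grad D x (stat M x - x) <= - rho * U x].
Proof.
move=> rho0 hrho; have [V [D [sV [c' c'0 hV] hD]]] := projective_form.
have l1 : 0 < 1 - lam by rewrite subr_gt0.
have k0 : 0 < kappa.
  by rewrite -(pmulr_lgt0 _ l1) -(pmulr_rgt0 _ (ltr0Sn R 1)) mulrA (lt_trans rho0).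
have [L [L0 _ lL]] := bdLip_mean_timeV.
(* How far the clock 1 / [mt x] may fall below its value 1 - lam at [nu] while the rate stays at
   least rho. *)
pose ep := (1 - lam) - rho / (2 * kappa).
have ep0 : 0 < ep by rewrite subr_gt0 ltr_pdivrMr ?mulr_gt0 // mulrC.
(* On V <= de the point is within ep / (L + 1) of [nu], hence the clock within ep of 1 - lam;
   [L + 1] because the Lipschitz constant may be 0. *)
pose de := c' * (ep / (L + 1)) ^+ 2.
have L1 : 0 < L + 1 by rewrite ltr_wpDl.
have de0 : 0 < de by rewrite mulr_gt0 // exprn_gt0 // divr_gt0.
pose T := \sum_i a i 0.
have a1 i : 1 <= a i 0 by apply: exit_time_ge1 hM hM1 lam1 hu u0 i.
have T0 : 0 < T.
  rewrite /T (bigD1 (Ordinal d0)) //= ltr_pwDl ?(lt_le_trans ltr01) //.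
  by rewrite sumr_ge0 // => i _; rewrite (le_trans ler01).
(* [T^-1] bounds the clock from below on the whole simplex; the exponent compensates for this worst
   case. *)
have [m hm] : exists m : nat, rho <= kappa * T^-1 * m.+1%:R.
  exists (Num.truncn (rho / (kappa * T^-1))).
  rewrite mulrC -ler_pdivrMr ?mulr_gt0 ?invr_gt0 // ltW //.
  by rewrite truncnS_gt.
have sU := smoothD sV (smoothM (smooth_cst (de^-1 ^+ m)) (smoothX m.+1 sV)).
have V0 x : simplex x -> 0 <= V x.
  by move=> hx; apply: le_trans (hV _ hx); rewrite mulr_ge0 ?sqr_ge0 // ltW.
do 2 eexists; split; [exact: sU| |] => /=.
  exists c' => // x hx; rewrite (le_trans (hV _ hx)) // lerDl mulr_ge0 //.
    by rewrite exprn_ge0 // invr_ge0 ltW.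
  by rewrite exprn_ge0 // V0.
move=> x hx; set h := stat M x - x.
pose Y := (V x / de) ^+ m.
have Y0 : 0 <= Y by rewrite exprn_ge0 // divr_ge0 ?V0 // ltW.
set DU := (X in grad X x h).
have -> : grad DU x h = (1 + m.+1%:R * Y) * grad D x h.
  rewrite /grad /DU mulr_sumr; apply: eq_bigr => k _.
  by rewrite /Y exprMn /=; ring.
have -> : V x + de^-1 ^+ m * V x ^+ m.+1 = (1 + Y) * V x.
  by rewrite /Y exprMn exprS; ring.
apply: le_trans (ler_wpM2l _ (hD _ hx)) _.
  by rewrite addr_ge0 // mulr_ge0.
rewrite -subr_ge0.
rewrite (_ : _ - _ = ((1 + m.+1%:R * Y) * (2 * kappa * (mt x)^-1)
                      - rho * (1 + Y)) * V x); last by ring.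
rewrite mulr_ge0 ?V0 // subr_ge0.
set s := (mt x)^-1.
have t1 := mean_time_ge1 hM hM1 lam1 hu u0 hx.
have s0 : T^-1 <= s.
  rewrite lef_pV2 ?posrE ?T0 ?(lt_le_trans ltr01 t1) //.
  by apply: linear_simplex_le => // i; rewrite (le_trans ler01).
have m1 : 1 <= m.+1%:R :> R by rewrite ler1n.
have [Vde|Vde] := leP (V x) de.
  have sl : rho <= 2 * kappa * s.
    rewrite -ler_pdivrMl ?mulr_gt0 // mulrC.
    have : L * norm1 (x - nu) <= ep.
      have n0 := norm1_ge0 (x - nu).
      have : norm1 (x - nu) <= ep / (L + 1).
        rewrite -ler_sqr ?nnegrE // ?divr_ge0 ?(ltW ep0) ?(ltW L1) //.
        by rewrite -(ler_pM2l c'0) (le_trans (hV _ hx)).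
      rewrite ler_pdivlMr // => hh; apply: le_trans hh.
      by rewrite mulrC ler_wpM2l // lerDl.
    have := lL _ _ hx nuK; rewrite mean_time_nu invrK -/s /ep => h1 h2.
    have := le_trans h1 h2; rewrite ler_distl => /andP [+ _].
    by rewrite opprB addrC subrK.
  have : 1 + Y <= 1 + m.+1%:R * Y by rewrite lerD2l ler_peMl.
  move=> h1; rewrite [leRHS]mulrC; apply: ler_pM => //; first exact: ltW.
  by rewrite addr_ge0.
(* Far from [nu], Y >= 1: the power term alone decays by 2 rho Y V, which covers rho (1 + Y) V. *)
have Y1 : 1 <= Y by rewrite exprn_ege1 // ler_pdivlMr // mul1r ltW.
have : rho <= kappa * s * m.+1%:R.
  apply: le_trans hm _; rewrite ler_wpM2r // ler_wpM2l //; exact: ltW.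
have s0' : 0 <= s by apply: le_trans s0; rewrite invr_ge0 ltW.
have ks : 0 <= kappa * s by rewrite mulr_ge0 // ltW.
move=> h1; have h2 := ler_wpM2r Y0 h1.
have : rho <= rho * Y by rewrite ler_peMr // ltW.
by move: h2; nra.
Qed.

End LyapunovFunction.

(** * Drift of the corrected Lyapunov function over one step *)

Section OneStep.
Context {R : realType} {d : nat}.
Variables (M : 'M[R]_d) (lam : R) (u : 'cV[R]_d).
Hypothesis hM : nonneg_mx M.
Hypothesis hM1 : forall i, (M *m ones) i 0 <= 1.
Hypothesis lam01 : 0 < lam < 1.
Hypothesis hu : M *m u = lam *: u.
Hypothesis u0 : forall i, 0 < u i 0.
Let lam1 : lam < 1 := lam_lt1 lam01.
Local Notation A := (resolvent M).
Local Notation a := (exit_time M).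
Implicit Types (phi psi : 'rV[R]_d -> 'I_d -> R) (x : 'rV[R]_d) (g : R).

Lemma delta_simplex (j : 'I_d) : simplex (delta_mx 0 j : 'rV[R]_d).
Proof.
split=> [i|]; first by rewrite mxE; case: (_ && _).
rewrite (bigD1 j) //= mxE !eqxx big1 ?addr0 // => i ij.
by rewrite mxE (negPf ij) andbF.
Qed.

Definition update g x (j : 'I_d) : 'rV[R]_d := (1 - g) *: x + g *: delta_mx 0 j.

Lemma update_simplex g x j : 0 <= g <= 1 -> simplex x -> simplex (update g x j).
Proof.
move=> /andP [g0 g1] [x0 x1]; have [e0 e1] := delta_simplex j.
split=> [i|].
  rewrite mxE [X in X + _]mxE [X in _ + X]mxE.
  by rewrite addr_ge0 ?mulr_ge0 ?subr_ge0.
under eq_bigr => i _ do rewrite mxE [X in X + _]mxE [X in _ + X]mxE.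
by rewrite big_split /= -!mulr_sumr x1 e1 !mulr1 subrK.
Qed.

Lemma updateB g x j : update g x j - x = g *: (delta_mx 0 j - x).
Proof. by rewrite /update scalerBl scale1r scalerBr addrAC [x - _]addrC addrK addrC. Qed.

Lemma reset_ge0 x i j : simplex x -> 0 <= reset M x i j.
Proof.
move=> [x0 _]; rewrite mxE [X in _ + X]mxE big_ord1 addr_ge0 // mulr_ge0 //.
by rewrite mxE [X in X + _]mxE [X in _ + X]mxE subr_ge0.
Qed.

Lemma reset_sum x i : simplex x -> \sum_j reset M x i j = 1.
Proof.
move=> [_ x1].
under eq_bigr => j _ do rewrite mxE [X in _ + X]mxE big_ord1.
rewrite big_split /= -mulr_sumr x1 mulr1.
have -> : (ones - M *m ones) i 0 = 1 - (M *m ones) i 0.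
  by rewrite mxE [X in X + _]mxE [X in _ + X]mxE.
rewrite (_ : \sum_j M i j = (M *m ones) i 0); first by rewrite addrC subrK.
by rewrite [RHS]mxE; apply: eq_bigr => j _; rewrite [ones _ _]mxE mulr1.
Qed.

(** Transition operator of the Markov pair (x_n, X_n); the position is updated with the new state
    j. *)
Definition step g phi x i : R := \sum_j reset M x i j * phi (update g x j) j.

(** By [poissonP] this is [reset M x *m poisson M x] paired with the gradient. The extra average
    over one transition is due to the update using the new state. *)
Definition corrector (D : 'I_d -> 'rV[R]_d -> R) x (i : 'I_d) : R :=
  \sum_k (poisson M x i k - (i == k)%:R + stat M x 0 k) * D k x.

Lemma corrector_bdLip D i : (forall k, bdLip (D k)) ->
  bdLip (fun x => corrector D x i).
Proof.
move=> hD; apply: bdLip_sum => k; apply: bdLipM => //.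
have bs := bdLip_stat hM hM1 lam01 hu u0 k.
apply: bdLipD => //; apply: bdLipB; last exact: bdLip_cst.
have := bdLipB (bdLip_cst (A i k)) (bdLipM (bdLip_cst (a i 0)) bs).
congr bdLip; apply/funext => x.
by rewrite /poisson [RHS]mxE [X in _ = _ + X]mxE [X in _ = _ - X]mxE big_ord1.
Qed.

Lemma bdLip_uniform (H : 'rV[R]_d -> 'I_d -> R) : (forall i, bdLip (H^~ i)) ->
  exists C : R, [/\ 0 <= C, forall x i, simplex x -> `|H x i| <= C &
    forall x y i, simplex x -> simplex y -> `|H x i - H y i| <= C * norm1 (x - y)].
Proof.
move=> /(_ _)/cid h; pose c i := projT1 (h i).
have c0 i : 0 <= c i by case: (projT2 (h i)).
have le i : c i <= \sum_i c i by rewrite (bigD1 i) //= lerDl sumr_ge0.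
exists (\sum_i c i); split; first exact: sumr_ge0.
  move=> x i hx; apply: le_trans (le i).
  by case: (projT2 (h i)) => _ hb _; exact: hb.
move=> x y i hx hy; apply: le_trans (ler_wpM2r (norm1_ge0 _) (le i)).
by case: (projT2 (h i)) => _ _; apply.
Qed.

Lemma gradZ D x (c : R) (h : 'rV[R]_d) : grad D x (c *: h) = c * grad D x h.
Proof.
by rewrite /grad mulr_sumr; apply: eq_bigr => k _; rewrite mxE mulrA.
Qed.

(** The increment seen from state i is exchanged for the mean field at the price of a difference of
    correctors, which is absorbed into the Lyapunov function. *)
Lemma corrector_poisson D x i : simplex x ->
  \sum_j reset M x i j * (grad D x (delta_mx 0 j - x) + corrector D x j) =
  corrector D x i + grad D x (stat M x - x).
Proof.
move=> hx.
have e j : grad D x (delta_mx 0 j - x) + corrector D x j =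
    \sum_k (poisson M x j k + stat M x 0 k - x 0 k) * D k x.
  rewrite /grad /corrector -big_split /=; apply: eq_bigr => k _.
  by rewrite [(_ - x) _ _]mxE [(- x) _ _]mxE [delta_mx _ _ _ _]mxE eqxx /=
    [k == j]eq_sym; ring.
under eq_bigr => j _ do rewrite e mulr_sumr.
rewrite exchange_big /= /corrector /grad -big_split /=; apply: eq_bigr => k _.
under eq_bigr => j _ do rewrite mulrA.
rewrite -mulr_suml -mulrDl; congr (_ * _).
have pe : \sum_j reset M x i j * poisson M x j k =
    poisson M x i k - (i == k)%:R + stat M x 0 k.
  transitivity ((reset M x *m poisson M x) i k); first by rewrite [RHS]mxE.
  rewrite (poissonP hM hM1 lam1 hu u0 hx) [LHS]mxE [(_ - 1%:M) _ _]mxE.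
  rewrite [(- 1%:M) _ _]mxE [1%:M _ _]mxE [(ones *m _) _ _]mxE big_ord1.
  by rewrite [ones _ _]mxE mul1r.
rewrite -pe [(_ - x) _ _]mxE [(- x) _ _]mxE.
under eq_bigr => j _ do rewrite -addrA mulrDr.
by rewrite big_split /= -mulr_suml reset_sum // mul1r.
Qed.

Lemma step_drift U D (rho : R) : 0 <= rho -> smooth U D ->
  (forall x, simplex x -> 0 <= U x) ->
  (forall x, simplex x -> grad D x (stat M x - x) <= - rho * U x) ->
  exists H : 'rV[R]_d -> 'I_d -> R, exists C : R,
  (forall x i, simplex x -> 0 <= H x i <= C) /\
  forall g g', 0 <= g' -> g' <= g -> g <= 1 -> forall x i, simplex x ->
    step g (fun y j => U y + g' * H y j) x i <=
    (1 - rho * g) * (U x + g * H x i) + C * g ^+ 2.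
Proof.
move=> rho0 [_ bD [CU CU0 tU]] U0 hdrift.
have [CH [CH0 bH lH]] := bdLip_uniform (fun i => corrector_bdLip i bD).
(* The shift makes H non-negative, so [g' <= g] gives [g' * H <= g * H] and the difference of
   successive step sizes never has to be estimated. *)
pose H x i := corrector D x i + CH.
have H0 x i : simplex x -> 0 <= H x i <= 2 * CH.
  move=> hx; have := bH x i hx; rewrite ler_norml /H => /andP [h1 h2].
  by apply/andP; split; lra.
(* The first [2 * CH] lets the same constant bound H. The others come from the Taylor remainder (a
   move is at most 2g), the variation of H along the move, and the term rho g^2 H. *)
exists H, (2 * CH + (4 * CU + 2 * CH + 2 * rho * CH)); split.
  move=> x i hx; have /andP [-> h] := H0 x i hx; apply: le_trans h _.
  by rewrite lerDl !addr_ge0 ?mulr_ge0.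
move=> g g' g'0 g'g g1 x i hx.
have g0 : 0 <= g by apply: le_trans g'g.
have g01 : 0 <= g <= 1 by rewrite g0.
have key j : U (update g x j) + g' * H (update g x j) j <=
    U x + g * CH + (4 * CU + 2 * CH) * g ^+ 2
    + g * (grad D x (delta_mx 0 j - x) + corrector D x j).
  have hy := update_simplex j g01 hx.
  have n2 : norm1 (update g x j - x) <= 2 * g.
    rewrite updateB norm1Z ger0_norm // mulrC ler_wpM2r //.
    by apply: norm1B_simplex => //; exact: delta_simplex.
  have h1 : U (update g x j) <= U x + g * grad D x (delta_mx 0 j - x) + CU * (4 * g ^+ 2).
    have := tU _ _ hx hy; rewrite ler_norml updateB gradZ -updateB => /andP [_ h].
    have h2 : norm1 (update g x j - x) ^+ 2 <= 4 * g ^+ 2.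
      have -> : 4 * g ^+ 2 = (2 * g) ^+ 2 by ring.
      by rewrite ler_sqr ?nnegrE ?norm1_ge0 // mulr_ge0.
    by have := ler_wpM2l CU0 h2; lra.
  have h3 : H (update g x j) j <= H x j + CH * (2 * g).
    have := lH _ _ j hy hx; rewrite ler_norml => /andP [_ h].
    by have := ler_wpM2l CH0 n2; rewrite /H; lra.
  have h4 : g' * H (update g x j) j <= g * (H x j + CH * (2 * g)).
    apply: (@le_trans _ _ (g * H (update g x j) j)).
      by rewrite ler_wpM2r //; case/andP: (H0 _ j hy).
    by rewrite ler_wpM2l.
  by move: h1 h4; rewrite /H; lra.
apply: (@le_trans _ _ (\sum_j reset M x i j * (U x + g * CH + (4 * CU + 2 * CH) * g ^+ 2
    + g * (grad D x (delta_mx 0 j - x) + corrector D x j)))).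
  by apply: ler_sum => j _; rewrite ler_wpM2l ?reset_ge0.
under eq_bigr => j _ do rewrite mulrDr [_ * (g * _)]mulrCA.
rewrite big_split /= -mulr_suml reset_sum // mul1r -mulr_sumr corrector_poisson //.
have := ler_wpM2l g0 (hdrift _ hx); have /andP [_ h] := H0 x i hx.
have h5 : rho * g ^+ 2 * H x i <= rho * g ^+ 2 * (2 * CH).
  by rewrite ler_wpM2l // mulr_ge0 ?sqr_ge0.
have h6 : 0 <= 2 * CH * g ^+ 2 by rewrite !mulr_ge0 ?sqr_ge0.
by move: h5; rewrite /H => h5 h7; nra.
Qed.

End OneStep.

(** * Scalar stochastic-approximation recursions *)

Section Recursions.
Context {R : realType}.
Variables (gamma b : nat -> R) (c C : R).
Hypothesis c0 : 0 < c.
Hypothesis C0 : 0 <= C.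
Hypothesis g01 : forall n, 0 < gamma n < 1.
Hypothesis gmono : {homo gamma : m n / (m <= n)%N >-> n <= m}.
Hypothesis b0 : forall n, 0 <= b n.
Hypothesis hb : forall n, b n.+1 <= (1 - c * gamma n) * b n + C * gamma n ^+ 2.
Hypothesis glim : gamma n @[n --> \oo] --> (0 : R).

Lemma gamma_gt0 n : 0 < gamma n. Proof. by case/andP: (g01 n). Qed.

Lemma near_le (f : nat -> R) l e : f n @[n --> \oo] --> l -> l < e ->
  exists N, forall n, (N <= n)%N -> f n <= e.
Proof.
move=> fl le; have [N _ hN] := cvgr_le _ fl _ le.
by exists N => n Nn; apply: hN.
Qed.

Lemma diverging_tail (N : nat) (B : R) : (\sum_(0 <= n <oo) (gamma n)%:E = +oo)%E ->
  exists n0, forall n, (n0 <= n)%N -> B <= \sum_(N <= k < n) gamma k.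
Proof.
move=> hs; apply: contrapT => h.
have mono (S := fun n => \sum_(N <= k < n) gamma k) m n : (m <= n)%N -> S m <= S n.
  move=> mn; rewrite /S; have [Nm|mN] := leqP N m.
    rewrite [leRHS](big_cat_nat (n := m)) //= lerDl sumr_ge0 // => k _.
    exact/ltW/gamma_gt0.
  rewrite big_geq ?(ltnW mN) // sumr_ge0 // => k _; exact/ltW/gamma_gt0.
have lt n : \sum_(N <= k < n) gamma k <= B.
  rewrite leNgt; apply/negP => hn; apply: h; exists n => m nm.
  by apply: le_trans (mono _ _ nm); exact: ltW.
have : (\sum_(0 <= n <oo) (gamma n)%:E <= (\sum_(0 <= k < N) gamma k + B)%:E)%E.
  apply: lime_le.
    by apply: is_cvg_nneseries => n _ _; rewrite lee_fin ltW // gamma_gt0.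
  near=> n.
  have Nn : (N <= n)%N by near: n; exists N.
  rewrite sumEFin lee_fin (big_cat_nat (n := N)) //= lerD2l.
  exact: lt.
by rewrite hs leye_eq.
Unshelve. all: by end_near.
Qed.

(** Once [C * gamma n <= c * a], the noise is paid by the level a = e/2, and the excess of b over a
    shrinks by the factor 1 - c gamma_n; divergence of the sum brings it below a. *)
Lemma robbins_cvg0 : (\sum_(0 <= n <oo) (gamma n)%:E = +oo)%E ->
  b n @[n --> \oo] --> (0 : R).
Proof.
move=> hs; apply/cvgrPdist_le => e e0.
pose a := e / 2; have a0 : 0 < a by rewrite divr_gt0.
have cV0 : 0 < c^-1 by rewrite invr_gt0.
have e2 : 0 < c * a / (C + 1) by rewrite divr_gt0 ?mulr_gt0 // ltr_wpDl.
have [N1 hN1] := near_le glim cV0; have [N2 hN2] := near_le glim e2.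
pose N := maxn N1 N2; pose S n := \sum_(N <= k < n) gamma k.
pose dd n := Num.max 0 (b n - a).
have dd0 n : 0 <= dd n by rewrite le_max lexx.
have S0 n : 0 <= S n by rewrite sumr_ge0 // => k _; exact/ltW/gamma_gt0.
have g1 n : (N <= n)%N -> 0 <= 1 - c * gamma n.
  move=> Nn; rewrite subr_ge0 -ler_pdivlMl // mulr1.
  by apply: hN1; rewrite (leq_trans _ Nn) // leq_maxl.
have dstep n : (N <= n)%N -> dd n.+1 <= (1 - c * gamma n) * dd n.
  move=> Nn; rewrite ge_max mulr_ge0 ?g1 //=.
  have gC : C * gamma n <= c * a.
    apply: (@le_trans _ _ ((C + 1) * gamma n)).
      by rewrite ler_wpM2r ?lerDl // ltW ?gamma_gt0.
    rewrite mulrC -ler_pdivlMr ?ltr_wpDl //.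
    by apply: hN2; rewrite (leq_trans _ Nn) // leq_maxr.
  have h1 : (1 - c * gamma n) * (b n - a) <= (1 - c * gamma n) * dd n.
    by rewrite ler_wpM2l ?g1 // le_max lexx orbT.
  have h2 : C * gamma n * gamma n <= c * a * gamma n.
    by rewrite ler_wpM2r // ltW ?gamma_gt0.
  by have := hb n; lra.
(* Induction through (1 + p + q)(1 - q) <= 1 + p: the product of the contraction factors is bounded
   by the inverse of a diverging sum. *)
have inv n : (N <= n)%N -> (1 + c * S n) * dd n <= dd N.
  elim: n => [|n IH] Nn.
    have -> : N = 0%N by move: Nn; rewrite leqn0 => /eqP.
    by rewrite /S big_geq // mulr0 addr0 mul1r.
  move: Nn; rewrite leq_eqVlt => /orP [/eqP <-|].
    by rewrite /S big_geq // mulr0 addr0 mul1r.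
  rewrite ltnS => Nn; apply: le_trans (IH Nn).
  have -> : S n.+1 = S n + gamma n by rewrite /S big_nat_recr.
  have cS : 0 <= c * S n by rewrite mulr_ge0 // ltW.
  have cg : 0 <= c * gamma n by rewrite mulr_ge0 // ltW // gamma_gt0.
  apply: (@le_trans _ _ ((1 + c * (S n + gamma n)) * ((1 - c * gamma n) * dd n))).
    by rewrite ler_wpM2l ?dstep // mulrDr !addr_ge0.
  rewrite mulrA ler_wpM2r // [c * (_ + _)]mulrDr.
  have pq := mulr_ge0 cS cg; have qq := mulr_ge0 cg cg.
  by move: pq qq; set p := c * S n; set q := c * gamma n => *; lra.
have [n0 hn0] := diverging_tail N (dd N / a / c) hs.
exists (maxn n0 N) => // n /= hn; rewrite sub0r normrN ger0_norm //.
have Nn : (N <= n)%N by apply: leq_trans hn; apply: leq_maxr.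
have h1 : dd N / a <= c * S n.
  rewrite [leRHS]mulrC -ler_pdivrMr //; apply: hn0.
  by apply: leq_trans hn; apply: leq_maxl.
have h2 : dd n <= a.
  have h3 := inv n Nn.
  have : dd N <= c * S n * a by rewrite -ler_pdivrMr.
  have cS : 0 <= c * S n by rewrite mulr_ge0 // ltW.
  move=> h4; rewrite leNgt; apply/negP => h5.
  have : c * S n * a <= c * S n * dd n by rewrite ler_wpM2l // ltW.
  by have := lt_trans a0 h5; lra.
have : b n - a <= dd n by rewrite le_max lexx orbT.
by move: h2; rewrite /a; lra.
Qed.

(** Pick m strictly between l and c. The slack c - m absorbs the noise, and the remaining factor 1 -
    m gamma_n is at most gamma_(n+1) / gamma_n, because the logarithmic ratio is eventually below
    m. *)
Lemma robbins_rate l : log_ratio gamma k @[k --> \oo] --> l -> 0 <= l -> l < c ->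
  exists2 K : R, 0 < K & forall n, b n <= K * gamma n.
Proof.
move=> hl l0 lc.
pose m := (l + c) / 2.
have lm : l < m by rewrite /m; lra.
have mc : m < c by rewrite /m; lra.
have [N1 hN1] := near_le hl lm.
have cV0 : 0 < c^-1 by rewrite invr_gt0.
have [N2 hN2] := near_le glim cV0.
pose N := maxn N1 N2.
have q0 k : 0 <= b k / gamma k by rewrite divr_ge0 // ltW // gamma_gt0.
(* The summands provide positivity, the noise, and the bound up to index N, from which the induction
   starts. *)
pose K := 1 + C / (c - m) + \sum_(k < N.+1) b k / gamma k.
have mc0 : 0 < c - m by rewrite subr_gt0.
have K0 : 0 < K.
  by rewrite /K !ltr_pwDl // ?divr_ge0 ?(ltW mc0) // sumr_ge0.
have KC : C <= K * (c - m).
  rewrite -ler_pdivrMr // /K addrAC lerDr addr_ge0 // sumr_ge0 //.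
exists K => // n; have [nN|Nn] := leqP n N.
  rewrite -ler_pdivrMr ?gamma_gt0 // /K (bigD1 (Ordinal (nN : (n < N.+1)%N))) //=.
  rewrite addrCA lerDl !addr_ge0 ?divr_ge0 ?(ltW mc0) //.
  by rewrite sumr_ge0.
elim: n Nn => // n IH; rewrite ltnS => Nn.
have {}IH : b n <= K * gamma n.
  move: Nn; rewrite leq_eqVlt => /orP [/eqP Nn|]; last exact: IH.
  rewrite -ler_pdivrMr ?gamma_gt0 // /K (bigD1 (Ordinal (ltnSn N))) //= -Nn.
  rewrite addrCA lerDl !addr_ge0 ?divr_ge0 ?(ltW mc0) //.
  by rewrite sumr_ge0.
have g0 := gamma_gt0 n; have g0' := gamma_gt0 n.+1.
have gle : gamma n.+1 <= gamma n by apply: gmono.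
have cg : 0 <= 1 - c * gamma n.
  rewrite subr_ge0 -ler_pdivlMl // mulr1.
  by apply: hN2; rewrite (leq_trans _ Nn) // leq_maxr.
have h1 : b n.+1 <= K * gamma n * (1 - m * gamma n).
  have h := ler_wpM2l cg IH; have := hb n.
  have : C * gamma n ^+ 2 <= K * (c - m) * gamma n ^+ 2 by rewrite ler_wpM2r // sqr_ge0.
  by lra.
apply: (le_trans h1); rewrite -mulrA ler_pM2l //.
have lr : ln (gamma n / gamma n.+1) <= m * gamma n.+1.
  rewrite [leRHS]mulrC -ler_pdivrMl //; apply: hN1; rewrite (leq_trans _ Nn) //.
  exact: leq_maxl.
have h2 : gamma n <= expR (m * gamma n.+1) * gamma n.+1.
  rewrite -ler_pdivrMr // -[leLHS]lnK ?posrE ?divr_gt0 //.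
  by rewrite ler_expR.
apply: (@le_trans _ _ (gamma n * expR (- (m * gamma n.+1)))).
  rewrite ler_pM2l // (le_trans _ (expR_ge1Dx _)) // lerD2l lerN2 ler_wpM2l //.
  by rewrite (le_trans l0) // ltW.
by rewrite expRN ler_pdivrMr ?expR_gt0 // mulrC.
Qed.

End Recursions.

(** * From the process to a positive functional on test functions *)

Section PathLaw.
Context {R : realType} {d : nat}.
Variables (P : 'M[R]_d.+1) (gamma : nat -> R).
Hypothesis hP : stochastic P.
Hypothesis g01 : forall n, 0 < gamma n < 1.
Context {disp : measure_display} {Omega : measurableType disp}.
Variables (Pr : probability Omega R).
Variables (X : nat -> Omega -> 'I_d) (x : nat -> Omega -> 'rV[R]_d).
Hypothesis hXx : is_algorithm Pr P gamma X x.
Local Notation M := (killed P).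
Implicit Types (phi psi : 'rV[R]_d -> 'I_d -> R).

Let mX n i : measurable (X n @^-1` [set i]).
Proof. by case: hXx. Qed.

Lemma history_sub m n : (m <= n)%N -> history X m `<=` history X n.
Proof.
move=> mn; apply: sub_sigma_algebra2 => A [k [i [km ->]]].
by exists k, i; split=> //; apply: leq_trans km mn.
Qed.

Lemma historyX n i : history X n (X n @^-1` [set i]).
Proof. by apply: sub_gen_smallest; exists n, i. Qed.

Lemma historyI n A B : history X n A -> history X n B -> history X n (A `&` B).
Proof.
set G := [set A | exists k i, (k <= n)%N /\ A = X k @^-1` [set i]].
exact: (@measurableI _ (g_sigma_algebraType G)).
Qed.

Lemma history_measurable n A : history X n A -> measurable A.
Proof.
apply: smallest_sub; first exact: sigma_algebra_measurable.
by move=> B [k [i [_ ->]]].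
Qed.

(* Every set in the sigma-algebra of X_0 is saturated for X_0. *)
Lemma x0_const w w' : X 0%N w = X 0%N w' -> x 0%N w = x 0%N w'.
Proof.
move=> e; apply/rowP => j.
have [_ _ /(_ j) mx _ _] := hXx.
have sat : history X 0 `<=`
    [set B | forall w w', X 0%N w = X 0%N w' -> B w -> B w'].
  apply: smallest_sub.
    split=> [w1 w2 _ []|A hA w1 w2 e12 [_ nA]|F hF w1 w2 e12 [n _ Fn]].
    - by split=> // A2; apply: nA; apply: hA A2.
    - by exists n => //; apply: hF Fn.
  move=> B [k [i [k0 ->]]] w1 w2.
  by move: k0; rewrite leqn0 => /eqP ->; rewrite /preimage /= => ->.
have h := sat _ (mx [set x 0%N w ord0 j] (measurable_set1 _)) w w' e erefl.
by rewrite /preimage /= in h; exact: esym.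
Qed.

Definition pr (A : set Omega) : R := fine (Pr A).

Lemma pr_ge0 A : 0 <= pr A.
Proof. by rewrite /pr fine_ge0. Qed.

Lemma prE A : measurable A -> Pr A = (pr A)%:E.
Proof. by move=> mA; rewrite /pr fineK // fin_num_measure. Qed.

Lemma pr_total m A : measurable A ->
  pr A = \sum_k pr (A `&` X m @^-1` [set k]).
Proof.
move=> mA; apply: EFin_inj; rewrite -prE // -sumEFin.
have mAk k : measurable (A `&` X m @^-1` [set k]) by apply: measurableI.
under eq_bigr => k _ do rewrite -prE //.
rewrite -measure_bigsetU_ord //.
  congr (Pr _); apply/seteqP; split=> w.
    by move=> Aw; rewrite (bigD1 (X m w)) //=; left.
  by elim/big_ind: _ => // [B C hB hC [/hB|/hC]|k _ []].
move=> i j _ _ [w [[_ wi] [_ wj]]].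
by rewrite -wi -wj.
Qed.

(* E[phi(x_(n+p), X_(n+p)) | x_n = x, X_n = i] *)
Fixpoint chain (n p : nat) phi : 'rV[R]_d -> 'I_d -> R :=
  if p is q.+1 then step M (gamma n) (chain n.+1 q phi) else phi.

(** On an event where X_n and x_n are both constant the conditional probability is a constant, and
    its integral is elementary. *)
Lemma pr_cond n k i xi A : history X n A ->
  (forall w, A w -> X n w = i /\ x n w = xi) ->
  pr (A `&` X n.+1 @^-1` [set k]) = pr A * reset M xi i k.
Proof.
move=> hA hc; have mA := history_measurable hA.
apply: EFin_inj; rewrite -prE; last exact: measurableI.
have [_ _ _ hcp _] := hXx; have [_ /(_ _ hA) e] := hcp n k.
rewrite setIC e.
rewrite (eq_integral (cst (reset M xi i k)%:E)); last first.
  move=> w; rewrite inE => /hc [-> ->].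
  by rewrite reset_kernelE.
transitivity ((reset M xi i k)%:E * Pr A)%E; first exact: integral_cst.
by rewrite prE // -EFinM mulrC.
Qed.

(** Intersecting with {X_(n+1) = k} again fixes both the state and the position, the update being
    deterministic, so [pr_cond] can be iterated. *)
Lemma pr_chain p n i xi A j : history X n A ->
  (forall w, A w -> X n w = i /\ x n w = xi) ->
  pr (A `&` X (n + p) @^-1` [set j]) =
  pr A * chain n p (fun _ k => (k == j)%:R) xi i.
Proof.
elim: p n i xi A => [|p IH] n i xi A hA hc /=.
  rewrite addn0; case: eqVneq => [ij|ij].
    rewrite mulr1; congr pr; apply/seteqP; split=> [w []//|w Aw].
    by split=> //; rewrite /preimage /= -ij; case: (hc _ Aw).
  rewrite mulr0 (_ : _ `&` _ = set0) ?/pr ?measure0 //.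
  apply/seteqP; split=> // w [/hc [wi _]]; rewrite /preimage /= wi => e.
  by rewrite e eqxx in ij.
have mA := history_measurable hA.
rewrite (pr_total n.+1); last exact: measurableI.
rewrite /step mulr_sumr; apply: eq_bigr => k _.
have hAk : history X n.+1 (A `&` X n.+1 @^-1` [set k]).
  by apply: historyI; [exact: (history_sub (leqnSn n)) hA|exact: historyX].
rewrite setIAC addnS -addSn (IH _ k (update (gamma n) xi k)) //.
  by rewrite (pr_cond k hA hc) mulrA.
move=> w [/hc [_ wx] wk]; split=> //.
by have [_ _ _ _ ->] := hXx; rewrite wx wk.
Qed.

(** [chain] unfolds its first step, whereas the recursion in time needs the last one. *)
Lemma chain_step n p phi :
  chain n p.+1 phi = chain n p (step M (gamma (n + p)) phi).
Proof.
elim: p n => [|p IH] n; first by rewrite addn0.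
by rewrite -[LHS]/(step M (gamma n) (chain n.+1 p.+1 phi)) IH addSnnS.
Qed.

Let M0 : nonneg_mx M := killed_ge0 hP.
Lemma killed_ones_le1 i : (M *m ones) i 0 <= 1.
Proof. by rewrite killed_row_sum // lerBlDr lerDl; case: hP. Qed.

Lemma chain_le n p phi psi :
  (forall x i, simplex x -> phi x i <= psi x i) ->
  forall x i, simplex x -> chain n p phi x i <= chain n p psi x i.
Proof.
move=> h; elim: p n => [|p IH] n y i hy /=; first exact: h.
apply: ler_sum => j _; rewrite ler_wpM2l ?reset_ge0 //.
  exact: killed_ones_le1.
apply: IH; apply: update_simplex => //.
by have /andP [h1 h2] := g01 n; rewrite !ltW.
Qed.

Lemma chain_linear n p a phi psi : chain n p (fun x i => a * phi x i + psi x i) =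
  fun x i => a * chain n p phi x i + chain n p psi x i.
Proof.
elim: p n => [|p IH] n //=.
rewrite IH; apply/funext => y; apply/funext => i.
rewrite /step mulr_sumr -big_split /=; apply: eq_bigr => j _.
by rewrite mulrDr mulrCA.
Qed.

Lemma chain_one n p y i : simplex y -> chain n p (fun _ _ => 1) y i = 1.
Proof.
elim: p n y i => [|p IH] n y i hy //=.
transitivity (\sum_j reset M y i j); last exact: reset_sum.
apply: eq_bigr => j _.
rewrite IH ?mulr1 //; apply: update_simplex => //.
by have /andP [h1 h2] := g01 n; rewrite !ltW.
Qed.

(* The joint law of (x_n, X_n), as a functional on test functions. *)
Lemma joint_expectation : exists E : nat -> ('rV[R]_d -> 'I_d -> R) -> R,
  [/\ forall n phi psi, (forall x i, simplex x -> phi x i <= psi x i) ->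
        E n phi <= E n psi,
      forall n a phi psi,
        E n (fun x i => a * phi x i + psi x i) = a * E n phi + E n psi,
      forall n, E n (fun _ _ => 1) = 1,
      forall n phi, E n.+1 phi = E n (step M (gamma n) phi) &
      forall n j, law Pr X n 0 j = E n (fun _ k => (k == j)%:R)].
Proof.
(* [xi i] is the value of x_0 on {X_0 = i}; when that event is empty, any point of the simplex
   does. *)
have /choice [xi hxi] : forall i, exists y, simplex y /\
    forall w, X 0%N w = i -> x 0%N w = y.
  move=> i; have [[w wi]|no] := pselect (exists w, X 0%N w = i).
    exists (x 0%N w); split; first by case: hXx.
    by move=> w' w'i; apply: x0_const; rewrite wi.
  exists (delta_mx 0 i); split; first exact: delta_simplex.
  by move=> w wi; exfalso; apply: no; exists w.
exists (fun n phi => \sum_i pr (X 0%N @^-1` [set i]) * chain 0 n phi (xi i) i).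
split.
- move=> n phi psi h; apply: ler_sum => i _; rewrite ler_wpM2l ?pr_ge0 //.
  by apply: chain_le => //; case: (hxi i).
- move=> n a phi psi; rewrite mulr_sumr -big_split /=; apply: eq_bigr => i _.
  by rewrite chain_linear mulrDr mulrCA.
- move=> n; transitivity (\sum_i pr (setT `&` X 0%N @^-1` [set i])).
    apply: eq_bigr => i _; rewrite chain_one ?mulr1 ?setTI //.
    by case: (hxi i).
  by rewrite -pr_total // /pr probability_setT.
- by move=> n phi; apply: eq_bigr => i _; rewrite chain_step add0n.
- move=> n j; rewrite mxE -[fine _]/(pr _) (pr_total 0); last exact: mX.
  apply: eq_bigr => i _; rewrite setIC -[n in LHS]add0n.
  apply: pr_chain; first exact: historyX.
  by move=> w wi; split=> //; case: (hxi i) => _; apply.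
Qed.

End PathLaw.

(** * Geometric contraction of a stochastic matrix with a loop *)

Section Contraction.
Context {R : realType} {d : nat}.
Implicit Types (K : 'M[R]_d) (m : 'rV[R]_d).

Lemma stoch_exp K k : K *m ones = ones -> K ^+ k *m ones = ones.
Proof.
move=> h; elim: k => [|k IH]; first by rewrite expr0 [LHS]mul1mx.
by rewrite exprSr -[LHS]/((K ^+ k *m K) *m ones) -mulmxA h.
Qed.

Lemma norm1_mulmx K m (c : R) : nonneg_mx K ->
  (forall i, \sum_j K i j <= c) -> norm1 (m *m K) <= c * norm1 m.
Proof.
move=> K0 Kc; rewrite /norm1 mulr_sumr.
apply: (@le_trans _ _ (\sum_j \sum_i `|m 0 i| * K i j)).
  apply: ler_sum => j _; rewrite mxE; apply: le_trans (ler_norm_sum _ _ _) _.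
  by apply: ler_sum => i _; rewrite normrM (ger0_norm (K0 _ _)).
rewrite exchange_big /=; apply: ler_sum => i _.
by rewrite -mulr_sumr mulrC ler_wpM2r.
Qed.

Lemma stoch_row_sum K i : K *m ones = ones -> \sum_j K i j = 1.
Proof.
move=> /(congr1 (fun z : 'cV[R]_d => z i 0)); rewrite mxE [X in _ = X]mxE => <-.
by apply: eq_bigr => j _; rewrite [ones _ _]mxE mulr1.
Qed.

(** Subtracting [al] from column i0 does not change [m *m K], as [m] has total mass 0, and lowers
    every row sum to 1 - al. *)
Lemma doeblin_step K m (i0 : 'I_d) (al : R) : nonneg_mx K -> K *m ones = ones ->
  0 <= al -> (forall i, al <= K i i0) -> m *m ones = 0 ->
  norm1 (m *m K) <= (1 - al) * norm1 m.
Proof.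
move=> K0 K1 al0 hal m0.
pose K' : 'M[R]_d := \matrix_(i, j) (K i j - (if j == i0 then al else 0)).
have -> : m *m K = m *m K'.
  apply/rowP => j; rewrite mxE [RHS]mxE.
  under [RHS]eq_bigr => i _ do rewrite [K' _ _]mxE mulrBr.
  rewrite sumrB -mulr_suml (_ : \sum_i m 0 i = 0) ?mul0r ?subr0 //.
  by rewrite -mulmx_ones m0 mxE.
apply: norm1_mulmx => [i j|i].
  by rewrite mxE; case: eqP => [->|_]; rewrite subr_ge0.
under eq_bigr => j _ do rewrite mxE.
by rewrite sumrB (stoch_row_sum i K1) -big_mkcond big_pred1_eq.
Qed.

(** The loop at i0 lets a path wait there, so a single exponent serves all starting states. *)
Lemma exp_pos_later K (i i0 : 'I_d) k n : nonneg_mx K -> 0 < K i0 i0 ->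
  0 < (K ^+ k) i i0 -> (k <= n)%N -> 0 < (K ^+ n) i i0.
Proof.
move=> K0 Kii hk /subnK <-; elim: (n - k)%N => [|l IH] //.
rewrite addSn exprSr mxE (bigD1 i0) //= ltr_pwDl ?mulr_gt0 //.
by apply: sumr_ge0 => j _; rewrite mulr_ge0 // nonneg_exp.
Qed.

Lemma geometric_contraction K (i0 : 'I_d) : nonneg_mx K -> K *m ones = ones ->
  0 < K i0 i0 -> (forall i, exists k, 0 < (K ^+ k) i i0) ->
  exists B rho : R, [/\ 0 < B, 0 < rho < 1 & forall m p, m *m ones = 0 ->
    norm1 (m *m K ^+ p) <= B * rho ^+ p * norm1 m].
Proof.
move=> K0 K1 Kii /choice [k hk].
pose N := (\sum_i k i).+1.
have kN i : (k i <= N)%N by rewrite /N (bigD1 i) //= leqW // leq_addr.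
have pos i : 0 < (K ^+ N) i i0 by apply: exp_pos_later (hk i) (kN i).
pose i1 := [arg min_(i < i0) ((K ^+ N) i i0)]%O.
pose al := (K ^+ N) i1 i0.
have al0 : 0 < al by apply: pos.
have hal i : al <= (K ^+ N) i i0.
  by rewrite /al /i1; case: arg_minP => // i2 _; apply.
have KN1 := stoch_exp N K1; have KN0 := nonneg_exp N K0.
have al1 : al <= 1.
  rewrite -(stoch_row_sum i1 KN1) (bigD1 i0) //= lerDl.
  by apply: sumr_ge0 => j _; exact: KN0.
(* Bernoulli gives rho^N >= 1 - al/2 >= 1 - al, avoiding an N-th root; the factor 2 keeps rho
   positive even for al = 1. *)
pose rho := 1 - al / (2 * N%:R).
have N1 : 1 <= N%:R :> R by rewrite ler1n.
have a2 : al / (2 * N%:R) <= 1 / 2.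
  by rewrite ler_pdivrMr ?mulr_gt0 //; lra.
have a0 : 0 < al / (2 * N%:R).
  by rewrite divr_gt0 // mulr_gt0.
have rho0 : 0 < rho by rewrite /rho; lra.
have rho1 : rho < 1 by rewrite /rho; lra.
have bern n : 1 - n%:R * (al / (2 * N%:R)) <= rho ^+ n.
  elim: n => [|n IH]; first by rewrite mul0r subr0 expr0.
  rewrite exprS; apply: le_trans (ler_wpM2l (ltW rho0) IH).
  have : 0 <= n%:R * (al / (2 * N%:R)) ^+ 2 by rewrite mulr_ge0 ?sqr_ge0.
  by rewrite /rho -natr1; lra.
have alrho : 1 - al <= rho ^+ N.
  apply: le_trans (bern N); rewrite lerD2l lerN2.
  have -> : N%:R * (al / (2 * N%:R)) = al / 2.
    by field; rewrite gt_eqF // (lt_le_trans ltr01).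
  by rewrite ler_pdivrMr // ler_peMr ?ler1n // ltW.
(* The prefactor pays for the p mod N steps on which only non-expansion is known. *)
exists (rho ^+ N)^-1, rho; split; [by rewrite invr_gt0 exprn_gt0|by rewrite rho0|].
move=> m p m0.
have iter q : norm1 (m *m K ^+ (N * q)) <= (rho ^+ N) ^+ q * norm1 m.
  elim: q => [|q IH]; first by rewrite muln0 !expr0 mul1r [m *m _]mulmx1.
  rewrite mulnSr exprD -[m *m _]/(m *m (K ^+ (N * q) *m K ^+ N)) mulmxA.
  apply: le_trans (doeblin_step KN0 KN1 (ltW al0) hal _) _.
    by rewrite -mulmxA stoch_exp.
  rewrite exprS -mulrA; apply: ler_pM => //; last exact: norm1_ge0.
  by rewrite subr_ge0.
rewrite {1}(divn_eq p N) mulnC exprD.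
rewrite -[m *m _]/(m *m (K ^+ (N * (p %/ N)) *m K ^+ (p %% N))) mulmxA.
have K1' i : \sum_j (K ^+ (p %% N)) i j <= 1.
  by rewrite stoch_row_sum // stoch_exp.
apply: le_trans (norm1_mulmx _ (nonneg_exp _ K0) K1') _.
rewrite mul1r; apply: le_trans (iter _) _; rewrite ler_wpM2r ?norm1_ge0 //.
rewrite mulrC ler_pdivlMr ?exprn_gt0 // -exprM -exprD.
apply: ler_wiXn2l; [exact: ltW|exact: ltW|].
rewrite [leqLHS](divn_eq p N) mulnC leq_add2l; apply: ltnW.
by rewrite ltn_mod.
Qed.

End Contraction.

(** * Positive normalised linear functionals *)

Section Functional.
Context {R : realType} {d : nat}.
Variable E : ('rV[R]_d -> 'I_d -> R) -> R.
Hypothesis Ele : forall phi psi,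
  (forall x i, simplex x -> phi x i <= psi x i) -> E phi <= E psi.
Hypothesis Elin : forall a phi psi,
  E (fun x i => a * phi x i + psi x i) = a * E phi + E psi.
Hypothesis Eone : E (fun _ _ => 1) = 1.

Lemma E_zero : E (fun _ _ => 0) = 0.
Proof.
have := Elin (-1) (fun _ _ => 1) (fun _ _ => 1); rewrite Eone mulN1r addNr => e.
rewrite -[RHS]e.
by congr E; apply/funext => x; apply/funext => i; rewrite mulN1r addNr.
Qed.

Lemma E_scale a phi : E (fun x i => a * phi x i) = a * E phi.
Proof.
rewrite -[RHS]addr0 -[in RHS]E_zero -Elin.
by congr E; apply/funext => x; apply/funext => i; rewrite addr0.
Qed.

Lemma E_cst c : E (fun _ _ => c) = c.
Proof.
rewrite -[RHS]mulr1 -[in RHS]Eone -E_scale.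
by congr E; apply/funext => x; apply/funext => i; rewrite mulr1.
Qed.

Lemma E_add phi psi : E (fun x i => phi x i + psi x i) = E phi + E psi.
Proof.
rewrite -[E phi]mul1r -Elin.
by congr E; apply/funext => x; apply/funext => i; rewrite mul1r.
Qed.

Lemma E_sum (I : Type) (r : seq I) (F : I -> 'rV[R]_d -> 'I_d -> R) :
  E (fun x i => \sum_(k <- r) F k x i) = \sum_(k <- r) E (F k).
Proof.
elim: r => [|k r IH].
  rewrite big_nil -[RHS]E_zero; congr E; apply/funext => x; apply/funext => i.
  by rewrite big_nil.
rewrite big_cons -IH -E_add; congr E; apply/funext => x; apply/funext => i.
by rewrite big_cons.
Qed.

Lemma E_norm phi : `|E phi| <= E (fun x i => `|phi x i|).
Proof.
rewrite ler_norml -mulN1r -E_scale; apply/andP; split; apply: Ele => x i _.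
  by rewrite mulN1r lerNl ler_normr lexx orbT.
exact: ler_norm.
Qed.

Lemma E_ge0 phi : (forall x i, simplex x -> 0 <= phi x i) -> 0 <= E phi.
Proof. by move=> h; rewrite -E_zero; apply: Ele. Qed.

End Functional.

(** * The law as a perturbed orbit of K[nu] *)

Section LawPerturbation.
Context {R : realType} {d : nat}.
Variables (M : 'M[R]_d) (lam : R) (nu : 'rV[R]_d) (gamma : nat -> R).
Hypothesis hM : nonneg_mx M.
Hypothesis hM1 : forall i, (M *m ones) i 0 <= 1.
Hypothesis hnu : nu *m M = lam *: nu.
Hypothesis nuK : simplex nu.
Variable E : nat -> ('rV[R]_d -> 'I_d -> R) -> R.
Hypothesis Ele : forall n phi psi,
  (forall x i, simplex x -> phi x i <= psi x i) -> E n phi <= E n psi.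
Hypothesis Elin : forall n a phi psi,
  E n (fun x i => a * phi x i + psi x i) = a * E n phi + E n psi.
Hypothesis Eone : forall n, E n (fun _ _ => 1) = 1.
Hypothesis Estep : forall n phi, E n.+1 phi = E n (step M (gamma n) phi).

Variable mu : nat -> 'rV[R]_d.
Hypothesis mu_E : forall n j, mu n 0 j = E n (fun _ k => (k == j)%:R).

Let K := reset M nu.

Definition mean_dist n : R := E n (fun x _ => norm1 (x - nu)).

Lemma nu_reset : nu *m K = nu.
Proof.
have n1 : nu *m ones = 1%:M.
  by rewrite [LHS]mx11_scalar mulmx_ones nuK.2.
rewrite /K /reset mulmxDr mulmxA mulmxBr n1 mulmxA hnu -scalemxAl n1.
by rewrite scale_scalar_mx mulr1 -raddfB mul_scalar_mx -scalerDl addrC subrK scale1r.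
Qed.

Lemma resetE x i j :
  reset M x i j = M i j + (ones - M *m ones) i 0 * x 0 j.
Proof. by rewrite mxE [X in _ + X]mxE big_ord1. Qed.

Lemma reset_ones x : simplex x -> reset M x *m ones = ones.
Proof.
move=> hx; apply/matrixP => i j; rewrite mxE [RHS]mxE -(reset_sum M i hx).
by apply: eq_bigr => k _; rewrite [ones _ _]mxE mulr1.
Qed.

Lemma mu_sum n : \sum_j mu n 0 j = 1.
Proof.
under eq_bigr => j _ do rewrite mu_E.
rewrite -(E_sum (Elin n) (Eone n)) -[RHS](Eone n); congr (E n _).
apply/funext => x; apply/funext => i.
by rewrite (bigD1 i) //= eqxx big1 ?addr0 // => j ji; rewrite eq_sym (negPf ji).
Qed.

Lemma mu_simplex n : simplex (mu n).
Proof.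
split=> [i|]; last exact: mu_sum.
by rewrite mu_E; apply: (E_ge0 (Ele n) (Elin n) (Eone n)).
Qed.

(** K[x] and K[nu] differ by the killing probability, at most 1, times x - nu. *)
Lemma law_one_step n :
  norm1 ((mu n.+1 - nu) - (mu n - nu) *m K) <= mean_dist n.
Proof.
have -> : (mu n.+1 - nu) - (mu n - nu) *m K = mu n.+1 - mu n *m K.
  by rewrite mulmxBl nu_reset opprB addrA subrK.
have e j : (mu n.+1 - mu n *m K) 0 j =
    E n (fun x k => (ones - M *m ones) k 0 * (x 0 j - nu 0 j)).
  have h1 : mu n.+1 0 j = E n (fun x k => reset M x k j).
    rewrite mu_E Estep; congr (E n _); apply/funext => x; apply/funext => k.
    rewrite /step (bigD1 j) //= eqxx mulr1 big1 ?addr0 // => l lj.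
    by rewrite (negPf lj) mulr0.
  have h2 : (mu n *m K) 0 j = E n (fun x k => K k j).
    rewrite mxE; under eq_bigr => k _ do rewrite mu_E mulrC -(E_scale (Elin n) (Eone n)).
    rewrite -(E_sum (Elin n) (Eone n)); congr (E n _).
    apply/funext => x; apply/funext => k.
    rewrite (bigD1 k) //= eqxx mulr1 big1 ?addr0 // => l lk.
    by rewrite eq_sym (negPf lk) mulr0.
  rewrite [LHS]mxE [(- (mu n *m K)) _ _]mxE h1 h2 -mulN1r addrC -Elin; congr (E n _).
  apply/funext => x; apply/funext => k.
  by rewrite /K !resetE; ring.
rewrite /norm1; under eq_bigr => j _ do rewrite e.
apply: (@le_trans _ _ (\sum_j E n (fun x _ => `|(x - nu) 0 j|))).
  apply: ler_sum => j _; apply: le_trans (E_norm (Ele n) (Elin n) (Eone n) _) _.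
  apply: Ele => x k hx; rewrite normrM.
  have -> : (x - nu) 0 j = x 0 j - nu 0 j by rewrite mxE [X in _ + X]mxE.
  have -> : (ones - M *m ones) k 0 = 1 - (M *m ones) k 0.
    by rewrite mxE [X in X + _]mxE [X in _ + X]mxE.
  rewrite ler_piMl // ger0_norm ?subr_ge0 // lerBlDr lerDl mxE sumr_ge0 // => l _.
  by rewrite mulr_ge0 // mxE.
by rewrite -(E_sum (Elin n) (Eone n)).
Qed.

(** [K] does not expand [norm1], so the one-step errors simply add up. *)
Lemma law_perturbation n p :
  norm1 ((mu (n + p)%N - nu) - (mu n - nu) *m K ^+ p) <=
  \sum_(k < p) mean_dist (n + k).
Proof.
have K0 : nonneg_mx K by move=> i j; apply: reset_ge0.
elim: p => [|p IH].
  rewrite addn0 expr0 [X in norm1 (_ - X)]mulmx1 subrr big_ord0.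
  by rewrite /norm1 big1 // => i _; rewrite mxE normr0.
rewrite big_ord_recr /= addnS.
have -> : mu (n + p).+1 - nu - (mu n - nu) *m K ^+ p.+1 =
  (mu (n + p)%N - nu - (mu n - nu) *m K ^+ p) *m K
  + ((mu (n + p).+1 - nu) - (mu (n + p)%N - nu) *m K).
  rewrite exprSr [X in _ - X]mulmxA; move: (mu n - nu) => z.
  by rewrite [in RHS]mulmxBl [RHS]addrC addrA subrK.
apply: le_trans (norm1_triangle _ _) _; apply: lerD (law_one_step _).
apply: le_trans IH; rewrite -[leRHS]mul1r; apply: norm1_mulmx => // i.
by rewrite reset_sum.
Qed.

End LawPerturbation.

(** * Mean-square estimate for x_n *)

Lemma steps_cvg0 (R : realType) (gamma : nat -> R) :
  admissible_steps gamma -> gamma n @[n --> \oo] --> (0 : R).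
Proof.
move=> [g01 _ _ gl]; apply/cvgrPdist_le => e e0.
have [N0 _ hN0] := cvgr_le _ gl _ e0.
exists (maxn N0 (Num.truncn (expR 1 : R)).+1) => // n /= hn.
have ln1 : 1 <= ln n%:R :> R.
  rewrite -[leLHS]expRK ler_ln ?posrE ?expR_gt0 //.
    apply: ltW; apply: lt_le_trans (truncnS_gt _) _.
    by rewrite ler_nat (leq_trans _ hn) // leq_maxr.
  by rewrite ltr0n (leq_trans _ hn) // (leq_trans _ (leq_maxr _ _)).
have g0 : 0 <= gamma n by case/andP: (g01 n) => /ltW.
rewrite sub0r normrN ger0_norm //.
apply: (@le_trans _ _ (gamma n * ln n%:R)); first by rewrite ler_peMr.
by apply: hN0; rewrite /= (leq_trans _ hn) // leq_maxl.
Qed.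

Section MeanSquare.
Context {R : realType} {d : nat}.
Variables (P : 'M[R]_d.+1) (nu : 'rV[R]_d) (lam : R) (lams : seq R[i]).
Hypothesis d0 : (0 < d)%N.
Hypothesis hP : stochastic P.
Hypothesis h0 : absorbing0 P.
Hypothesis hirr : irreducible_class P.
Hypothesis hnu : is_qsd P nu lam.
Hypothesis hlams : is_spectrum (killed P) (lam%:C :: lams).
Local Notation M := (killed P).

Lemma qsd_pos i : 0 < nu 0 i.
Proof.
have [[nu0 nu1] _ hn] := hnu.
apply: (nonneg_eigen_pos (killed_ge0 hP) (killed_irreducible hP h0 hirr) hn) => //.
apply: contra_eq_neq nu1 => ->; rewrite big1 ?(eq_sym 0) ?oner_neq0 // => j _.
by rewrite mxE.
Qed.

(** [Phi] takes the step size as an argument because its corrector carries that factor, which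
    differs at the two ends of a transition. *)
Lemma mean_square_gap : exists r : R, [/\ 0 < r, Rgap lam lams <= r &
  forall rho, 0 < rho -> rho < 2 * r ->
  exists Phi : R -> 'rV[R]_d -> 'I_d -> R, exists c C : R,
  [/\ 0 < c, 0 <= C,
      forall g x i, 0 <= g -> simplex x -> c * norm1 (x - nu) ^+ 2 <= Phi g x i &
      forall g g', 0 <= g' -> g' <= g -> g <= 1 -> forall x i, simplex x ->
        step M g (Phi g') x i <= (1 - rho * g) * Phi g x i + C * g ^+ 2]].
Proof.
have M0 := killed_ge0 hP; have M1 := killed_ones_le1 hP.
have irr := killed_irreducible hP h0 hirr.
have [nuK lam01 hn] := hnu; have [_ nu1] := nuK.
have l0 : 0 <= lam by case/andP: lam01 => /ltW.
have l1 : 0 < 1 - lam by rewrite subr_gt0; case/andP: lam01.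
have [u [hu u0 nuu]] := right_perron M0 irr l0 hn qsd_pos d0.
have [r [r0 rgap hr]] := gap_form d0 M0 irr lam01 hn qsd_pos nu1 hu u0 nuu hlams.
exists r; split=> // rho rho0 rhor.
(* With q midway between rho/2 and r, this [b] exceeds the threshold of [gap_form], and the
   resulting rate 2q near [nu] still exceeds rho. *)
pose q := (r + rho / 2) / 2; pose b := (1 - q) / (1 - lam).
have lb : (1 - lam) * b = 1 - q by rewrite mulrC divfK // gt_eqF.
have [|S [c [c0 ST Sc Sb]]] := hr b; first by rewrite lb /q; lra.
have kappaE : ((1 - lam)^-1 - b) * (1 - lam) = q.
  by rewrite mulrBl mulVf ?gt_eqF // [b * _]mulrC lb; ring.
have [||U [D [sU [c' c'0 hU] hD]]] :=
  lyapunov_function d0 M0 M1 lam01 hn nuK hu u0 ST c0 Sc Sb (rho := rho) => //.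
  by rewrite -mulrA kappaE /q; lra.
have U0 x : simplex x -> 0 <= U x.
  by move=> hx; apply: le_trans (hU _ hx); rewrite mulr_ge0 ?sqr_ge0 // ltW.
have [H [C [HC hdrift]]] := step_drift M0 M1 lam01 hu u0 (ltW rho0) sU U0 hD.
exists (fun g x i => U x + g * H x i), c', C; split=> //.
- have := delta_simplex (R := R) (Ordinal d0).
  by move=> /(HC _ (Ordinal d0)) /andP [h1 h2]; apply: le_trans h2.
- move=> g x i g0 hx; apply: le_trans (hU _ hx) _; rewrite lerDl mulr_ge0 //.
  by case/andP: (HC _ i hx).
Qed.

End MeanSquare.

(** Substitute for the Cauchy-Schwarz inequality: it passes from E |x_n - nu|^2 to E |x_n - nu| by
    monotonicity and linearity alone, with eta tuned afterwards. *)
Lemma le_sqr_div (R : realType) (t eta : R) : 0 < eta -> t <= eta + t ^+ 2 / eta.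
Proof.
move=> e0; rewrite -(ler_pM2r e0) mulrDl divfK ?gt_eqF //.
have : 0 <= (t - eta) ^+ 2 + t ^+ 2 by rewrite addr_ge0 ?sqr_ge0.
have : 0 <= eta ^+ 2 by rewrite sqr_ge0.
by move=> *; nra.
Qed.

(** * Convergence of the laws and its rate *)

Theorem corollary1p6 (R : realType) (d : nat) (hd : (2 <= d)%N)
  (P : 'M[R]_d.+1)
  (hP : stochastic P) (h0 : absorbing0 P) (hreach : reaches0 P)
  (hirr : irreducible_class P)
  (nu : 'rV[R]_d) (lam : R) (hnu : is_qsd P nu lam)
  (lams : seq R[i]) (hlams : is_spectrum (killed P) (lam%:C :: lams))
  (gamma : nat -> R) (hgamma : admissible_steps gamma)
  (disp : measure_display) (Omega : measurableType disp)
  (Pr : probability Omega R)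
  (X : nat -> Omega -> 'I_d) (x : nat -> Omega -> 'rV[R]_d)
  (hXx : is_algorithm Pr P gamma X x) :
  norm1 (law Pr X n - nu) @[n --> \oo] --> (0 : R) /\
  (condition_i gamma \/ condition_ii gamma (Rgap lam lams) ->
   exists C rho : R,
     [/\ 0 < C, 0 < rho < 1 &
         forall n p : nat,
           norm1 (law Pr X (n + p) - nu) <=
             C * (rho ^+ p + p%:R * Num.sqrt (gamma n))]).
Proof.
have d0 : (0 < d)%N by apply: leq_trans hd.
have gl := steps_cvg0 hgamma.
have [g01 gmono gsum _] := hgamma.
have g0 n : 0 < gamma n by case/andP: (g01 n).
have M0 := killed_ge0 hP; have M1 := killed_ones_le1 hP.
have [nuK lam01 hn] := hnu.
have nupos := qsd_pos hP h0 hirr hnu.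
have [E [Ele Elin Eone Estep Elaw]] := joint_expectation hP g01 hXx.
have pert := law_perturbation M0 M1 hn nuK Ele Elin Eone Estep Elaw.
have musimplex := mu_simplex Ele Elin Eone Elaw.
have musum := mu_sum Elin Eone Elaw.
pose K := reset (killed P) nu; rewrite -/K in pert.
have K0 : nonneg_mx K by move=> i j; apply: reset_ge0.
have K1 : K *m ones = ones by apply: reset_ones.
have [i0 hi0] := hreach.
have e0 : 0 < (ones - killed P *m ones) i0 0.
  rewrite mxE [(- _ : 'cV[R]_d) _ _]mxE (killed_row_sum _ hP) [ones _ _]mxE.
  by rewrite opprB addrC subrK.
(* A state killed with positive probability may be reset to itself, since [nu] charges every state:
   this loop is what rules out periodicity of K[nu]. *)
have Kii : 0 < K i0 i0.
  by rewrite /K resetE ltr_wpDl // mulr_gt0.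
have Kreach i : exists k, 0 < (K ^+ k) i i0.
  have [k hk] := killed_irreducible hP h0 hirr i i0; exists k.
  apply: lt_le_trans hk _.
  have : forall i j, (killed P ^+ k) i j <= (K ^+ k) i j.
    elim: k => [|k IH] i1 j; first by rewrite !expr0.
    rewrite !exprS mxE [leRHS]mxE; apply: ler_sum => l _.
    rewrite ler_pM ?nonneg_exp // /K resetE lerDl mulr_ge0 ?(ltW (nupos _)) //.
    rewrite mxE [(- _ : 'cV[R]_d) _ _]mxE [ones _ _]mxE subr_ge0; exact: M1.
  exact.
have [B [rho [B0 rho01 hB]]] := geometric_contraction K0 K1 Kii Kreach.
have base n p : norm1 (law Pr X (n + p) - nu) <=
    B * rho ^+ p * 2 + \sum_(k < p) mean_dist nu E (n + k).
  have -> : law Pr X (n + p) - nu = (law Pr X (n + p) - nu -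
     (law Pr X n - nu) *m K ^+ p) + (law Pr X n - nu) *m K ^+ p by rewrite subrK.
  apply: le_trans (norm1_triangle _ _) _; rewrite addrC; apply: lerD (pert _ _).
  apply: le_trans (hB _ p _) _.
    apply/matrixP => i j; rewrite !ord1 mulmxBl mxE [(- _ : 'M[R]_1) _ _]mxE.
    by rewrite !mulmx_ones musum nuK.2 subrr mxE.
  rewrite ler_wpM2l ?norm1B_simplex // mulr_ge0 ?(ltW B0) // exprn_ge0 //.
  by case/andP: rho01 => /ltW.
have [r [r0 rgap hr]] := mean_square_gap d0 hP h0 hirr hnu hlams.
have bound rate : 0 < rate -> rate < 2 * r ->
  exists b : nat -> R, exists c C : R, [/\ 0 < c, 0 <= C, forall n, 0 <= b n,
    forall n, b n.+1 <= (1 - rate * gamma n) * b n + C * gamma n ^+ 2 &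
    forall n eta, 0 < eta -> mean_dist nu E n <= eta + b n / c / eta].
  move=> rate0 rater; have [Phi [c [C [c0 C0 hPhi sPhi]]]] := hr _ rate0 rater.
  exists (fun n => E n (Phi (gamma n))), c, C; split=> //.
  - move=> n; apply: (E_ge0 (Ele n) (Elin n) (Eone n)) => y i hy.
    apply: le_trans (hPhi _ _ i (ltW (g0 n)) hy).
    by rewrite mulr_ge0 ?sqr_ge0 // ltW.
  - move=> n; rewrite Estep.
    have g1 : gamma n <= 1 by case/andP: (g01 n) => _ /ltW.
    rewrite -[C * _](E_cst (Elin n) (Eone n)) -Elin.
    apply: Ele => y i hy; apply: sPhi => //; first exact: ltW.
    exact: gmono.
  - move=> n eta eta0.
    rewrite -{1}(E_cst (Elin n) (Eone n) eta) addrC.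
    have -> : E n (Phi (gamma n)) / c / eta = (c^-1 / eta) * E n (Phi (gamma n)).
      by rewrite -mulrA mulrC.
    rewrite -Elin; apply: Ele => y i hy.
    apply: le_trans (le_sqr_div (norm1 (y - nu)) eta0) _.
    rewrite addrC lerD2r [leRHS]mulrAC ler_wpM2r ?invr_ge0 ?(ltW eta0) //.
    rewrite [leRHS]mulrC ler_pdivlMr // mulrC; exact: hPhi (ltW (g0 n)) hy.
split.
  have [||b [c [C [c0 C0 b0 hb hdist]]]] := bound r => //; first by lra.
  have b_cvg := robbins_cvg0 r0 C0 g01 b0 hb gl gsum.
  have dist_cvg e : 0 < e -> exists N, forall n, (N <= n)%N -> mean_dist nu E n <= e.
    move=> e_gt0; pose eta := e / 2; have eta0 : 0 < eta by rewrite divr_gt0.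
    have ce : 0 < eta * eta * c by rewrite !mulr_gt0.
    have [N hN] := near_le b_cvg ce; exists N => n Nn.
    apply: le_trans (hdist n _ eta0) _.
    have : b n / c / eta <= eta by rewrite !ler_pdivrMr // hN.
    by rewrite /eta; lra.
  apply/cvgrPdist_le => e e_gt0.
  have rho_cvg : rho ^+ p @[p --> \oo] --> (0 : R).
    apply: cvg_expr; case/andP: rho01 => h1 h2; by rewrite ger0_norm // ltW.
  have e1 : 0 < e / 2 / (B * 2) by rewrite !divr_gt0 // mulr_gt0.
  (* The number p of contraction steps is fixed before the time N after which its p errors are
     small; dividing by p.+1 covers p = 0. *)
  have [p hp] := near_le rho_cvg e1.
  have p1 : 0 < p.+1%:R :> R by [].
  have e2 : 0 < e / 2 / p.+1%:R by rewrite !divr_gt0.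
  have [N hN] := dist_cvg _ e2.
  exists (N + p)%N => // n /= hn'; rewrite sub0r normrN ger0_norm ?norm1_ge0 //.
  have pn : (p <= n)%N by apply: leq_trans hn'; rewrite leq_addl.
  rewrite -(subnK pn); apply: le_trans (base _ _) _.
  have h1 : B * rho ^+ p * 2 <= e / 2.
    by rewrite mulrAC mulrC -ler_pdivlMr ?mulr_gt0 // hp.
  have h2 : \sum_(k < p) mean_dist nu E (n - p + k) <= e / 2.
    apply: (@le_trans _ _ (\sum_(k < p) e / 2 / p.+1%:R)).
      apply: ler_sum => k _; apply: hN.
      by rewrite (leq_trans _ (leq_addr _ _)) // leq_subRL // addnC.
    rewrite sumr_const card_ord -[leLHS]mulr_natr -[leLHS]mulrA.
    rewrite ler_piMr ?divr_ge0 ?(ltW e_gt0) //.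
    by rewrite mulrC ler_pdivrMr // mul1r ler_nat.
  by lra.
move=> hcond.
have [l [l0 lr hl]] : exists l : R, [/\ 0 <= l, l < 2 * r &
    log_ratio gamma k @[k --> \oo] --> l].
  case: hcond => [[_ _ h]|[_ _ [gs [gs0 h hgap]]]].
    by exists 0; split=> //; rewrite mulr_gt0.
  exists gs^-1; split=> //; first by rewrite invr_ge0 ltW.
  by apply: lt_le_trans hgap _; rewrite ler_pM2l.
(* The midpoint is a rate still available below 2r and already above l, as [robbins_rate]
   demands. *)
have [||b [c [C [c0 C0 b0 hb hdist]]]] := bound ((l + 2 * r) / 2); [lra|lra|].
have [||L L0 hL] := robbins_rate _ C0 g01 gmono b0 hb gl hl l0; [lra|lra|].
pose C1 := 1 + L / c.
have C10 : 0 < C1 by rewrite ltr_wpDr // divr_ge0 // ltW.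
have dist_rate n k : mean_dist nu E (n + k) <= C1 * Num.sqrt (gamma n).
  (* Taking eta = sqrt(gamma) balances the two terms of [hdist] when b is of order gamma. *)
  have s0 : 0 < Num.sqrt (gamma (n + k)) by rewrite sqrtr_gt0.
  apply: le_trans (hdist _ _ s0) _.
  apply: (@le_trans _ _ (C1 * Num.sqrt (gamma (n + k)))); last first.
    by rewrite ler_wpM2l ?(ltW C10) // ler_wsqrtr // gmono // leq_addr.
  rewrite mulrDl mul1r lerD2l ler_pdivrMr // ler_pdivrMr //.
  have -> : L / c * Num.sqrt (gamma (n + k)) * Num.sqrt (gamma (n + k)) * c =
    L * Num.sqrt (gamma (n + k)) ^+ 2 by field; rewrite gt_eqF.
  by rewrite sqr_sqrtr ?(ltW (g0 _)).
exists (2 * B + C1), rho; split=> //; first by rewrite addr_gt0 // mulr_gt0.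
move=> n p; apply: le_trans (base _ _) _.
have h1 : \sum_(k < p) mean_dist nu E (n + k) <= C1 * (p%:R * Num.sqrt (gamma n)).
  rewrite mulrCA mulr_natl -[X in _ *+ X]card_ord -sumr_const.
  by apply: ler_sum => k _.
have h2 : 0 <= rho ^+ p by rewrite exprn_ge0 //; case/andP: rho01 => /ltW.
have h3 : 0 <= p%:R * Num.sqrt (gamma n) by rewrite mulr_ge0 // sqrtr_ge0.
by have := mulr_ge0 (ltW B0) h3; have := mulr_ge0 (ltW C10) h2; nra.
Qed.
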